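(* Let a Lie group $G$ act freely and properly from the left on a smooth manifold $M$ by $\Phi_h$, $h\in G$. Let $X_0,X_1,\dots,X_d$ be smooth vector fields on $M$ with $X_1,\dots,X_d$ pointwise linearly independent, let $\mathcal{D}=\mathrm{span}\{X_1,\dots,X_d\}$, and let $g$ be a $G$-invariant sub-Riemannian metric on $M$ that is positive-definite on $\mathcal{D}$, with $g_{ij}=g(X_i,X_j)$ for $1\le i,j\le d$. Consider the affine optimal control system $$\dot x=X_0(x)+\sum_{i=1}^d u_iX_i(x),\qquad C(x,u)=\tfrac12\sum_{i,j=1}^d g_{ij}(x)u_iu_j .$$ Suppose that this system is $G$-invariant (in the sense given in the context), and that $\mathbb{F}H_{\mathrm{df}}: T^*M\to TM$ restricted to $\mathbf{J}^{-1}(0)$ is non-degenerate, i.e. for each $x\in M$ it is injective on $\mathbf{J}^{-1}(0)\cap T_x^*M$, where $$H_{\mathrm{df}}(\lambda_x)=\tfrac12\sum_{i,j=1}^d g^{ij}(x)\langle\lambda_x,X_i(x)\rangle\langle\lambda_x,X_j(x)\rangle,\qquad \lambda_x\in T_x^*M,$$ is the drift-free optimal Hamiltonian, with $(g^{ij})$ the inverse matrix of $(g_{ij})$. Then the distribution $$\mathcal{H}=\mathbb{F}H_{\mathrm{df}}\big(\mathbf{J}^{-1}(0)\big)\subset TM$$ defines a principal connection on $\pi: M\to M/G$.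
   Context: $G$-invariance of the system means: $X_0$ is $G$-invariant, $T\Phi_h\circ X_0=X_0\circ\Phi_h$; the distribution is $G$-invariant, $T\Phi_h(\mathcal{D})=\mathcal{D}$, so that $T_x\Phi_h(X_i(x))=\sum_j R_i^j(x,h)X_j(\Phi_h(x))$ for an invertible $d\times d$ matrix $R(x,h)$; and the cost is invariant, $C\circ\Psi_h=C$, where $\Psi_h(x,u)=(\Phi_h(x),R^T(x,h)u)$, i.e. the $j$-th control component becomes $\sum_i R_i^j(x,h)u_i$; all for every $h\in G$. The metric being $G$-invariant means $g_{\Phi_h(x)}(T\Phi_hv,T\Phi_hw)=g_x(v,w)$ for $v,w\in\mathcal{D}_x$. The fiber derivative $\mathbb{F}H_{\mathrm{df}}$ is defined by $\langle\mathbb{F}H_{\mathrm{df}}(\alpha_x),\beta_x\rangle=\frac{d}{d\varepsilon}\big|_{\varepsilon=0}H_{\mathrm{df}}(\alpha_x+\varepsilon\beta_x)$ for $\alpha_x,\beta_x\in T^*_xM$. $\mathbf{J}: T^*M\to\mathfrak g^*$ is the momentum map $\langle\mathbf{J}(\lambda_x),\xi\rangle=\langle\lambda_x,\xi_M(x)\rangle$ for $\xi\in\mathfrak g$, with $\xi_M$ the infinitesimal generator. A principal connection on $\pi: M\to M/G$ is a distribution $\mathcal{H}\subset TM$ with $T\Phi_h(\mathcal{H})=\mathcal{H}$ for all $h\in G$ and $T_xM=\mathcal{H}_x\oplus\mathcal{V}_x$ for all $x\in M$, where $\mathcal{V}_x$ is the tangent space at $x$ to the $G$-orbit through $x$. 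*)

(* Defs.v *)
From HB Require Import structures.
From mathcomp Require Import all_boot all_order all_algebra.
From mathcomp Require Import all_classical all_reals all_analysis.
Set Implicit Arguments.
Unset Strict Implicit.
Unset Printing Implicit Defensive.
Import Order.TTheory GRing.Theory Num.Theory.
Import numFieldNormedType.Exports.
Local Open Scope classical_set_scope.
Local Open Scope ring_scope.

(* C^k on an open set U: for k + 1, differentiability on U together with the
   C^k property of all directional derivatives; V is finite-dimensional
   wherever this is used, so this is the usual notion. *)
Fixpoint Ck_on (R : realType) (V W : normedModType R) (k : nat) (U : set V)
    (f : V -> W) : Prop :=
  if k is k'.+1 then
    (forall x, U x -> differentiable f x) /\ (forall v, Ck_on k' U ('D_v f))
  else forall x, U x -> {for x, continuous f}.

Definition smooth_on (R : realType) (V W : normedModType R) (U : set V)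
    (f : V -> W) : Prop :=
  forall k, Ck_on k U f.

Definition smooth_near (R : realType) (V W : normedModType R) (f : V -> W)
    (p : V) : Prop :=
  exists U, [/\ open U, U p & smooth_on U f].

(* The atlas is indexed by the points of M: chart x is a chart around x, with
   domain chart_dom x and inverse chart_inv x; the values of chart x outside
   chart_dom x, and of chart_inv x outside the image of the chart, are junk.
   Every smooth atlas can be presented this way by choosing (with possible
   repetitions) one chart around each point. *)
HB.mixin Record isManifold (R : realType) (n : nat) M of Topological M := {
  chart_dom : M -> set M;
  chart : M -> M -> 'rV[R]_n;
  chart_inv : M -> 'rV[R]_n -> M;
  manifold_hausdorff : hausdorff_space M;
  manifold_second_countable : @second_countable M;
  open_chart_dom : forall x, open (chart_dom x);
  mem_chart_dom : forall x, chart_dom x x;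
  open_chart_image : forall x, open (chart x @` chart_dom x);
  chartK : forall x, {in chart_dom x, cancel (chart x) (chart_inv x)};
  chart_continuous : forall x, {in chart_dom x, continuous (chart x)};
  chart_inv_continuous :
    forall x, {in chart x @` chart_dom x, continuous (chart_inv x)};
  chart_compatible : forall x y,
    smooth_on (chart x @` (chart_dom x `&` chart_dom y))
      (chart y \o chart_inv x)
}.

#[short(type="manifoldType")]
HB.structure Definition Manifold (R : realType) (n : nat) :=
  {M of isManifold R n M & Topological M}.

Definition smooth_map (R : realType) (m n : nat) (M : manifoldType R m)
    (N : manifoldType R n) (f : M -> N) : Prop :=
  continuous f /\
  forall x, smooth_near (chart (f x) \o f \o chart_inv x) (chart x x).

(* Smoothness of f : M * N -> P for the product manifold structure on M * N,
   whose charts are the products of charts of M and N. *)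
Definition smooth_map2 (R : realType) (m n p : nat) (M : manifoldType R m)
    (N : manifoldType R n) (P : manifoldType R p) (f : M -> N -> P) : Prop :=
  continuous (fun z : M * N => f z.1 z.2) /\
  forall x y, smooth_near
    (fun z : 'rV[R]_m * 'rV[R]_n =>
       chart (f x y) (f (chart_inv x z.1) (chart_inv y z.2)))
    (chart x x, chart y y).

Definition smooth_fun (R : realType) (n : nat) (M : manifoldType R n)
    (f : M -> R) : Prop :=
  forall x, smooth_near (f \o chart_inv x : _ -> R^o) (chart x x).

HB.mixin Record isLieGroup (R : realType) (k : nat) G
    of Manifold R k G & Group G := {
  smooth_mulg : smooth_map2 (fun a b : G => (a * b)%g);
  smooth_invg : smooth_map (fun a : G => (a^-1)%g)
}.

#[short(type="lieGroupType")]
HB.structure Definition LieGroup (R : realType) (k : nat) :=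
  {G of isLieGroup R k G & Manifold R k G & Group G}.

(* A tangent vector at x is given by its components in the preferred chart
   chart x at x; its components in another chart around x are obtained by
   applying the derivative of the transition map. *)
Definition tangent (R : realType) (n : nat) (M : manifoldType R n) (x : M) :
    vectType R :=
  'rV[R]_n.

Definition cotangent (R : realType) (n : nat) (M : manifoldType R n) (x : M) :
    vectType R :=
  'Hom(tangent x, R^o).

(* The tangent map at x of a map f with f x = y.  The target point y is a
   separate argument because f x and y need not be convertible (e.g. for an
   action, Phi 1 x and x). *)
Definition tmap_to (R : realType) (m n : nat) (M : manifoldType R m)
    (N : manifoldType R n) (f : M -> N) (x : M) (y : N) :
    'Hom(tangent x, tangent y) :=
  linfun ('d (chart y \o f \o chart_inv x) (chart x x)).

Definition tmap (R : realType) (m n : nat) (M : manifoldType R m)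
    (N : manifoldType R n) (f : M -> N) (x : M) :
    'Hom(tangent x, tangent (f x)) :=
  tmap_to f x (f x).

Section VectorFields.
Context {R : realType} {n : nat} {M : manifoldType R n}.

Definition vf_rep (X : forall x : M, tangent x) (x0 : M) (z : 'rV[R]_n) :
    'rV[R]_n :=
  let y := chart_inv x0 z in
  'd (chart x0 \o chart_inv y) (chart y y) (X y).

Definition smooth_vf_on (U : set M) (X : forall x : M, tangent x) : Prop :=
  forall x, U x -> smooth_near (vf_rep X x) (chart x x).

Definition smooth_vf (X : forall x : M, tangent x) : Prop :=
  smooth_vf_on setT X.

Definition velocity (c : R -> M) (x : M) (v : tangent x) : Prop :=
  [/\ c 0 = x,
      \forall t \near (0 : R), {for t, continuous c},
      smooth_near (chart x \o c : R^o -> _) 0 &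
      derive1 (chart x \o c) 0 = v].

(* For S a submanifold of M, its tangent space at x as a subset of T_x M. *)
Definition tangent_to (S : set M) (x : M) : set (tangent x) :=
  [set v | exists2 c, velocity c v & \forall t \near (0 : R), S (c t)].

#[global] Arguments tangent_to S x _ : clear implicits.

(* A subset of TM is a family of subsets of its fibers.  It is a smooth
   distribution (subbundle) of rank r if it is locally spanned by r smooth
   pointwise linearly independent vector fields. *)
Definition smooth_distribution (H : forall x : M, set (tangent x)) : Prop :=
  exists r : nat, forall x0 : M, exists U : set M, [/\ open U, U x0 &
    exists Y : 'I_r -> forall x : M, tangent x,
      (forall i, smooth_vf_on U (Y i)) /\
      forall x, U x -> free [tuple Y i x | i < r] /\
        H x = [set` <<[tuple Y i x | i < r]>>%VS]].

Definition direct_sum (x : M) (A B : set (tangent x)) : Prop :=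
  exists U W : {vspace tangent x},
    [/\ A = [set` U], B = [set` W], (U + W)%VS = fullv & (U :&: W)%VS = 0%VS].

Definition distribution_span (d : nat) (X : 'I_d -> forall x : M, tangent x)
    (x : M) : {vspace tangent x} :=
  <<[tuple X i x | i < d]>>%VS.

(* g x is only meaningful on D x; its values elsewhere are unconstrained. *)
Definition sub_riemannian_metric (D : forall x : M, {vspace tangent x})
    (g : forall x : M, tangent x -> tangent x -> R) : Prop :=
  [/\ forall x a, {in D x & D x & D x, forall u v w,
        g x (a *: u + v) w = a * g x u w + g x v w},
      forall x, {in D x &, forall v w, g x v w = g x w v},
      forall x, {in D x, forall v, v != 0 -> 0 < g x v v} &
      forall Y Z : forall x : M, tangent x, smooth_vf Y -> smooth_vf Z ->
        (forall x, Y x \in D x) -> (forall x, Z x \in D x) ->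
        smooth_fun (fun x => g x (Y x) (Z x))].

(* The fiber derivative of H : T^*M -> R, with values in TM through the
   identification of T_x M with its bidual. *)
Definition fiber_derivative (H : forall x : M, cotangent x -> R) (x : M)
    (a : cotangent x) : tangent x :=
  xget 0 [set v | forall b : cotangent x,
    is_derive (0 : R^o) 1 (fun e : R^o => H x (a + e *: b) : R^o) (b v)].

#[global] Arguments fiber_derivative H x a : clear implicits.

Section ControlSystem.
Context {d : nat}.
Variables (X0 : forall x : M, tangent x) (X : 'I_d -> forall x : M, tangent x).
Variable g : forall x : M, tangent x -> tangent x -> R.

Definition gram (x : M) : 'M[R]_d := \matrix_(i, j) g (X i x) (X j x).

Definition cost (x : M) (u : 'rV[R]_d) : R :=
  2^-1 * \sum_(i < d) \sum_(j < d) gram x i j * u ord0 i * u ord0 j.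

Definition H_df (x : M) (a : cotangent x) : R :=
  2^-1 * \sum_(i < d) \sum_(j < d)
    invmx (gram x) i j * (a (X i x) : R) * (a (X j x) : R).

End ControlSystem.
End VectorFields.

Section Actions.
Context {R : realType} {n k d : nat} {M : manifoldType R n}
  {G : lieGroupType R k}.
Variable Phi : G -> M -> M.

Definition smooth_left_action : Prop :=
  [/\ forall x, Phi 1%g x = x,
      forall a b x, Phi (a * b)%g x = Phi a (Phi b x) &
      smooth_map2 Phi].

Definition free_action : Prop := forall h x, Phi h x = x -> h = 1%g.

Definition proper_action : Prop :=
  forall K : set (M * M), compact K ->
    compact ((fun z : G * M => (Phi z.1 z.2, z.2)) @^-1` K).

(* The derivative at t = 0 of Phi (exp (t xi)) x is, by the chain rule, the
   image of xi under the tangent map at 1 of the orbit map h |-> Phi h x. *)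
Definition infinitesimal_generator (xi : tangent (1%g : G)) (x : M) :
    tangent x :=
  tmap_to (Phi^~ x) 1%g x xi.

Definition vertical (x : M) : set (tangent x) := tangent_to (range (Phi^~ x)) x.

#[global] Arguments vertical x _ : clear implicits.

(* The Lie algebra of G is T_1 G as a vector space, and its dual is
   cotangent 1. *)
Definition momentum_map (x : M) (a : cotangent x) : cotangent (1%g : G) :=
  linfun (fun xi => a (infinitesimal_generator xi x)).

Definition momentum_zero (x : M) : set (cotangent x) :=
  [set a | momentum_map a = 0].

#[global] Arguments momentum_zero x _ : clear implicits.

Definition invariant_metric (D : forall x : M, {vspace tangent x})
    (g : forall x : M, tangent x -> tangent x -> R) : Prop :=
  forall h x, {in D x &, forall v w,
    g (Phi h x) (tmap (Phi h) x v) (tmap (Phi h) x w) = g x v w}.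

(* The i-th row of the matrix Q x h holds the components of T Phi_h (X_i x) in
   the frame X at Phi h x; controls being row vectors, Q^T u is u *m Q. *)
Definition invariant_system (X0 : forall x : M, tangent x)
    (X : 'I_d -> forall x : M, tangent x)
    (g : forall x : M, tangent x -> tangent x -> R) : Prop :=
  [/\ forall h x, tmap (Phi h) x (X0 x) = X0 (Phi h x),
      forall h x, (tmap (Phi h) x @: distribution_span X x)%VS =
                  distribution_span X (Phi h x) &
      exists Q : M -> G -> 'M[R]_d, [/\ forall x h, Q x h \in unitmx,
        forall x h i, tmap (Phi h) x (X i x) =
                      \sum_(j < d) Q x h i j *: X j (Phi h x) &
        forall h x u, cost X g (Phi h x) (u *m Q x h) = cost X g x u]].

Definition principal_connection (H : forall x : M, set (tangent x)) : Prop :=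
  [/\ smooth_distribution H,
      forall h x, tmap (Phi h) x @` H x = H (Phi h x) &
      forall x, direct_sum (H x) (vertical x)].

End Actions.

(* Main.v *)
(* Write A_x for the span of the infinitesimal generators at x and # for the
   fiber derivative of H_df, so that #a = sum g^ij a(X_i) X_j and
   H_x = #(ann A_x).  Since a(#a) = 0 forces a(X_i) = 0 for all i, hence
   #a = 0, non-degeneracy gives T_x M = H_x + A_x, a direct sum.

   A_x is the whole tangent space of the orbit, of constant dimension dim G:
   - Generators do not vanish.  If xi_M(x) = 0 for some xi <> 0, then the N-th
     power of the group element with coordinates xi / N moves x by o(1), while
     in the chart of G it stays in a compact annulus around the identity; a
     limit point contradicts freeness.  This avoids solving the flow equation.
   - A curve in the orbit lifts to a curve in G which is continuous at 0, by
     properness; comparing first order expansions at 0, and using that the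
     orbit map is immersive, its velocity lies in A_x.

   H_x is the g-orthogonal complement of the intersection of D_x and A_x in
   D_x, hence invariant.  For smoothness, complete a frame of generators near a
   point by constant combinations of the X_i to a frame of TM; the horizontal
   fields are the images under # of the dual coframe elements vanishing on the
   generators, and their coefficients on the X_i can be computed in any chart. *)
From HB Require Import structures.
Require Import Defs.
From mathcomp Require Import all_boot all_order all_algebra.
From mathcomp Require Import all_classical all_reals all_analysis.
From mathcomp Require Import ring lra.
Import Order.TTheory GRing.Theory Num.Theory.
Import numFieldNormedType.Exports.
Set Implicit Arguments.
Unset Strict Implicit.
Unset Printing Implicit Defensive.
Local Open Scope classical_set_scope.
Local Open Scope ring_scope.

(** * Calculus of [C^k] maps on open sets *)

Section CkOn.
Context {R : realType}.

Lemma near_eq_differentiable (V W : normedModType R) (f g : V -> W) (x : V) :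
  {near x, f =1 g} -> differentiable f x -> differentiable g x.
Proof.
move=> fg /diff_locallyP[dfc dff].
have dgE : g \o shift x = cst (g x) + 'd f x +o_ 0 id.
  apply/eqaddoP => e e0; move/eqaddoP/(_ _ e0): dff => dff.
  have fgx : f x = g x by exact: (nbhs_singleton fg).
  have fg0 : \forall h \near 0, f (h + x) = g (h + x).
    by move: fg; rewrite (near_shift 0 x) /=; apply: filterS => h; rewrite subr0.
  by near=> h; rewrite /= !fctE /= -(near fg0 h)// -fgx; near: h.
have dE : 'd g x = 'd f x :> (V -> W) by apply: diff_unique.
by apply/diff_locallyP; rewrite dE.
Unshelve. all: by end_near. Qed.

(** Openness of [U] turns equality on [U] into equality near each of its points, so that all
    directional derivatives agree on [U] as well. *)
Lemma Ck_on_ext (V W : normedModType R) k (U : set V) (f g : V -> W) :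
  open U -> {in U, f =1 g} -> Ck_on k U f -> Ck_on k U g.
Proof.
move=> oU; elim: k f g => [|k IH] f g fg /=.
  have nfg x : U x -> {near x, f =1 g}.
    move=> Ux; apply: filterS (open_nbhs_nbhs (conj oU Ux)) => y Uy.
    by apply: fg; rewrite inE.
  move=> cf x Ux; suff : g y @[y --> x] --> g x by [].
  rewrite -fg ?inE//; apply: cvg_trans (cf x Ux); apply: near_eq_cvg.
  exact: nfg.
have nfg x : U x -> {near x, f =1 g}.
  move=> Ux; apply: filterS (open_nbhs_nbhs (conj oU Ux)) => y Uy.
  by apply: fg; rewrite inE.
case=> df Df; split=> [x Ux|v].
  exact: near_eq_differentiable (nfg x Ux) (df x Ux).
apply: IH (Df v) => x; rewrite inE => Ux.
by apply: near_eq_derive; exact: nfg.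
Qed.

Lemma Ck_on_subset (V W : normedModType R) k (U U' : set V) (f : V -> W) :
  U' `<=` U -> Ck_on k U f -> Ck_on k U' f.
Proof.
move=> UU; elim: k f => [|k IH] f /=; first by move=> cf x /UU/cf.
by case=> df Df; split=> [x /UU/df //|v]; exact/IH/Df.
Qed.

Lemma Ck_onW (V W : normedModType R) k (U : set V) (f : V -> W) :
  Ck_on k.+1 U f -> Ck_on k U f.
Proof.
elim: k f => [|k IH] f; first by case=> df _ x /df/differentiable_continuous.
by case=> df Df; split=> // v; apply: IH.
Qed.

Lemma Ck_on_cst (V W : normedModType R) k (U : set V) (c : W) :
  Ck_on k U (fun _ : V => c).
Proof.
elim: k c => [|k IH] c /=; first by move=> x _; exact: cst_continuous.
split=> [x _|v]; first exact: differentiable_cst.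
suff -> : 'D_v (fun _ : V => c) = fun _ => 0 by exact: IH.
by apply/funext => x; rewrite -[RHS](derive_cst c x v).
Qed.

Lemma Ck_onD (V W : normedModType R) k (U : set V) (f g : V -> W) :
  open U -> Ck_on k U f -> Ck_on k U g -> Ck_on k U (fun x => f x + g x).
Proof.
move=> oU; elim: k f g => [|k IH] f g /=.
  by move=> cf cg x Ux; apply: continuousD; [exact: cf|exact: cg].
move=> [df Df] [dg Dg]; split=> [x Ux|v].
  by apply: differentiableD; [exact: df|exact: dg].
apply: (Ck_on_ext oU) (IH _ _ (Df v) (Dg v)) => x; rewrite inE => Ux.
by rewrite -deriveD//; apply: diff_derivable; [exact: df|exact: dg].
Qed.

(** By the Leibniz rule a directional derivative is a sum of two products, each with one
    differentiated factor; lowering the order of the other factor by [Ck_onW] makes the induction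
    hypothesis applicable. *)
Lemma Ck_onM (V : normedModType R) k (U : set V) (f g : V -> R^o) :
  open U -> Ck_on k U f -> Ck_on k U g ->
  Ck_on k U (fun x => f x * g x : R^o).
Proof.
move=> oU; elim: k f g => [|k IH] f g.
  by move=> cf cg x Ux; apply: continuousM; [exact: cf|exact: cg].
move=> cf cg; have [[df Df] [dg Dg]] := (cf, cg); split=> [x Ux|v].
  by apply: differentiableM; [exact: df|exact: dg].
have := Ck_onD oU (IH _ _ (Ck_onW cf) (Dg v)) (IH _ _ (Ck_onW cg) (Df v)).
apply: (Ck_on_ext oU) => x; rewrite inE => Ux.
have dfx : derivable f x v by apply: diff_derivable; exact: df.
have dgx : derivable g x v by apply: diff_derivable; exact: dg.
by rewrite [RHS](deriveM dfx dgx).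
Qed.

(** The derivative of [f^-1] is [- f^-1 * f^-1 * 'D_v f], so the inverse is as regular as its own
    previous order and ['D_v f] allow. *)
Lemma Ck_onV (V : normedModType R) k (U : set V) (f : V -> R^o) :
  open U -> (forall x, U x -> f x != 0) -> Ck_on k U f ->
  Ck_on k U (fun x => (f x)^-1 : R^o).
Proof.
move=> oU f0; elim: k f f0 => [|k IH] f f0.
  by move=> cf x Ux; apply: continuousV; [exact: f0|exact: cf].
move=> cf; have [df Df] := cf; split=> [x Ux|v].
  by apply: differentiableV; [exact: df|exact: f0].
have ci := IH _ f0 (Ck_onW cf).
have := Ck_onM oU (Ck_on_cst k U (-1 : R^o)) (Ck_onM oU (Ck_onM oU ci ci) (Df v)).
apply: (Ck_on_ext oU) => x; rewrite inE => Ux.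
have dfx : derivable f x v by apply: diff_derivable; exact: df.
by rewrite [RHS](deriveV (f0 x Ux) dfx) mulN1r scaleNr expr2 invfM.
Qed.

(* Precomposition with an affine map suffices here: curves and slices are
   affine in charts, so the general chain rule for C^k maps is not needed. *)
Lemma Ck_on_affine (V V' W : normedModType R) k (U : set V) (f : V -> W)
    (L : {linear V' -> V}) (a : V) :
  continuous L -> Ck_on k U f ->
  Ck_on k [set z | U (L z + a)] (fun z => f (L z + a)).
Proof.
move=> cL.
have dA z : differentiable (fun z => L z + a) z.
  by apply: differentiableD => //; apply: linear_differentiable.
elim: k f => [|k IH] f.
  move=> cf z Uz; apply: (@continuous_comp _ _ _ (fun z => L z + a) f).
    exact: differentiable_continuous.
  exact: cf.
move=> [df Df]; split=> [z Uz|v].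
  by apply: (@differentiable_comp _ _ _ _ (fun z => L z + a) f) => //; exact: df.
suff -> : 'D_v (fun z => f (L z + a)) = fun z => 'D_(L v) f (L z + a).
  exact: (IH ('D_(L v) f) (Df (L v))).
(* The two difference quotients are the same function of [h], so the identity holds even at points
   where the limit does not exist. *)
apply/funext => z; rewrite /derive.
suff -> : (fun h : R => h^-1 *: (((fun z => f (L z + a)) \o shift z) (h *: v)
      - f (L z + a)))
  = (fun h => h^-1 *: ((f \o shift (L z + a)) (h *: L v) - f (L z + a))) by [].
by apply/funext => h /=; rewrite (linearD L) (linearZ_LR L) /= addrA.
Qed.

Lemma Ck_on_coord (V : normedModType R) k m (U : set V) (f : V -> 'rV[R]_m) j :
  open U -> Ck_on k U f -> Ck_on k U (fun x => f x 0 j : R^o).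
Proof.
move=> oU; elim: k f => [|k IH] f.
  move=> cf x Ux; apply: (@continuous_comp _ _ _ f (fun N => N 0 j)).
    exact: cf.
  exact: coord_continuous.
move=> [df Df]; split=> [x Ux|v].
  apply: (@differentiable_comp _ _ _ _ f (fun N : 'rV_m => N 0 j : R^o)).
    exact: df.
  exact: differentiable_coord.
apply: (Ck_on_ext oU) (IH _ (Df v)) => x; rewrite inE => Ux.
by rewrite derive_mx ?mxE//; apply: diff_derivable; exact: df.
Qed.

(** A row-valued map is the finite sum of its coordinates times the standard basis rows; this gives
    continuity and differentiability, and higher orders follow since derivatives are taken
    coordinatewise. *)
Lemma Ck_on_rV (V : normedModType R) k m (U : set V) (f : V -> 'rV[R]_m) :
  open U -> (forall j, Ck_on k U (fun x => f x 0 j : R^o)) -> Ck_on k U f.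
Proof.
move=> oU.
have fE (h : V -> 'rV[R]_m) :
    h = fun x => \sum_j (h x 0 j : R^o) *: delta_mx (0 : 'I_1) j.
  by apply/funext => x; rewrite [LHS]row_sum_delta.
elim: k f => [|k IH] f.
  move=> cf x Ux; rewrite (fE f).
  apply: (cvg_big add_continuous) => j _; apply: cvgZr_tmp; exact: cf.
move=> cf; have df x : U x -> differentiable f x.
  move=> Ux; rewrite (fE f).
  have -> : (fun x => \sum_j (f x 0 j : R^o) *: delta_mx (0 : 'I_1) j)
    = \sum_(j < m) (fun x => (f x 0 j : R^o) *: delta_mx (0 : 'I_1) j).
    by apply/funext => y; rewrite fct_sumE.
  apply: differentiable_sum => j; apply: differentiableZl.
  by case: (cf j) => + _; apply.
split=> // v; apply: IH => j; case: (cf j) => _ /(_ v).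
apply: (Ck_on_ext oU) => x; rewrite inE => Ux.
by rewrite derive_mx ?mxE//; apply: diff_derivable; exact: df.
Qed.

End CkOn.

(** * Smooth germs, and smoothness of matrix operations *)

Section SmoothNear.
Context {R : realType} {V : normedModType R}.

Lemma smooth_near_ext (W : normedModType R) (f g : V -> W) (p : V) :
  (\near p, f p = g p) -> smooth_near f p -> smooth_near g p.
Proof.
move=> fg [U [oU Up sf]]; pose U' := U `&` interior [set x | f x = g x].
have oU' : open U' by apply: openI => //; exact: open_interior.
exists U'; split=> // k.
apply: Ck_on_ext (Ck_on_subset (@subIsetl _ _ _) (sf k)) => // x.
by rewrite inE => -[_ /interior_subset].
Qed.

Lemma smooth_near_nbhs (W : normedModType R) (f : V -> W) (p : V) :
  smooth_near f p -> \near p, smooth_near f p.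
Proof.
move=> [U [oU Up sf]]; apply: filterS (open_nbhs_nbhs (conj oU Up)) => x Ux.
by exists U.
Qed.

Lemma smooth_near_differentiable (W : normedModType R) (f : V -> W) (p : V) :
  smooth_near f p -> differentiable f p.
Proof. by move=> [U [_ Up /(_ 1%N)[+ _]]]; exact. Qed.

Lemma smooth_near_continuous (W : normedModType R) (f : V -> W) (p : V) :
  smooth_near f p -> {for p, continuous f}.
Proof. by move/smooth_near_differentiable/differentiable_continuous. Qed.

Lemma smooth_near_derive (W : normedModType R) (f : V -> W) (p v : V) :
  smooth_near f p -> smooth_near ('D_v f) p.
Proof.
by move=> [U [oU Up sf]]; exists U; split=> // k; case: (sf k.+1) => _ /(_ v).
Qed.

Lemma smooth_near_affine (V' W : normedModType R) (f : V -> W)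
    (L : {linear V' -> V}) (a : V) (z : V') :
  continuous L -> smooth_near f (L z + a) ->
  smooth_near (fun z => f (L z + a)) z.
Proof.
move=> cL [U [oU Up sf]]; exists [set z | U (L z + a)]; split=> //; last first.
  by move=> k; exact: Ck_on_affine.
apply: (@open_comp _ _ (fun z => L z + a)) => // x _.
by apply: continuousD; [exact: cL|exact: cst_continuous].
Qed.

Lemma smooth_near_cst (W : normedModType R) (c : W) (p : V) :
  smooth_near (fun _ => c) p.
Proof. by exists setT; split=> // [|k]; [exact: openT|exact: Ck_on_cst]. Qed.

Lemma smooth_near_coord m (f : V -> 'rV[R]_m) j (p : V) :
  smooth_near f p -> smooth_near (fun x => f x 0 j : R^o) p.
Proof.
by move=> [U [oU Up sf]]; exists U; split=> // k; exact: Ck_on_coord.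
Qed.

Lemma smooth_near_rV m (f : V -> 'rV[R]_m) (p : V) :
  (forall j, smooth_near (fun x => f x 0 j : R^o) p) -> smooth_near f p.
Proof.
move=> sf; have [U Usf] := choice sf.
have oj j : open_nbhs p (U j) by case: (Usf j) => oU Up _; split.
exists (interior [set x | forall j, U j x]); split.
- exact: open_interior.
- by apply: filter_forall => j; exact: open_nbhs_nbhs.
- move=> k; apply: Ck_on_rV => [|j]; first exact: open_interior.
  case: (Usf j) => _ _ /(_ k); apply: Ck_on_subset => x /interior_subset.
  exact.
Qed.

Implicit Types f g : V -> R^o.

Lemma smooth_nearD f g (p : V) : smooth_near f p -> smooth_near g p ->
  smooth_near (fun x => f x + g x : R^o) p.
Proof.
move=> [U [oU Up sf]] [U' [oU' Up' sg]]; exists (U `&` U'); split=> //.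
  exact: openI.
move=> k; apply: Ck_onD; first exact: openI.
  exact: Ck_on_subset (@subIsetl _ _ _) (sf k).
exact: Ck_on_subset (@subIsetr _ _ _) (sg k).
Qed.

Lemma smooth_nearM f g (p : V) : smooth_near f p -> smooth_near g p ->
  smooth_near (fun x => f x * g x : R^o) p.
Proof.
move=> [U [oU Up sf]] [U' [oU' Up' sg]]; exists (U `&` U'); split=> //.
  exact: openI.
move=> k; apply: Ck_onM; first exact: openI.
  exact: Ck_on_subset (@subIsetl _ _ _) (sf k).
exact: Ck_on_subset (@subIsetr _ _ _) (sg k).
Qed.

Lemma smooth_nearV f (p : V) : f p != 0 -> smooth_near f p ->
  smooth_near (fun x => (f x)^-1 : R^o) p.
Proof.
move=> fp sfp; have cf := smooth_near_continuous sfp; case: sfp => U [oU Up sf].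
pose U' := U `&` interior [set x | f x != 0].
have oU' : open U' by apply: openI => //; exact: open_interior.
exists U'; split=> //.
  by split=> //; exact: (cvgr_neq0 (f p) cf fp).
move=> k; apply: Ck_onV => //; first by move=> x [_ /interior_subset].
exact: Ck_on_subset (@subIsetl _ _ _) (sf k).
Qed.

Lemma smooth_near_sum (I : Type) (r : seq I) (P : pred I) (F : I -> V -> R^o) p :
  (forall i, smooth_near (F i) p) ->
  smooth_near (fun x => \sum_(i <- r | P i) F i x : R^o) p.
Proof.
move=> sF; elim: r => [|i r IH].
  by under eq_fun do rewrite big_nil; exact: smooth_near_cst.
under eq_fun do rewrite big_cons.
by case: (P i) => //; exact: smooth_nearD.
Qed.

Lemma smooth_near_prod (I : Type) (r : seq I) (P : pred I) (F : I -> V -> R^o) p :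
  (forall i, smooth_near (F i) p) ->
  smooth_near (fun x => \prod_(i <- r | P i) F i x : R^o) p.
Proof.
move=> sF; elim: r => [|i r IH].
  by under eq_fun do rewrite big_nil; exact: smooth_near_cst.
under eq_fun do rewrite big_cons.
by case: (P i) => //; exact: smooth_nearM.
Qed.

Definition smooth_mx m n (F : V -> 'M[R]_(m, n)) (p : V) : Prop :=
  forall i j, smooth_near (fun z => F z i j : R^o) p.

Lemma smooth_mx_ext m n (F F' : V -> 'M[R]_(m, n)) (p : V) :
  (\near p, F p = F' p) -> smooth_mx F p -> smooth_mx F' p.
Proof.
move=> FF sF i j; apply: smooth_near_ext (sF i j).
by apply: filterS FF => x ->.
Qed.

Lemma smooth_mx_cst m n (A : 'M[R]_(m, n)) (p : V) : smooth_mx (fun=> A) p.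
Proof. by move=> i j; exact: smooth_near_cst. Qed.

Lemma smooth_mxM m n q (F : V -> 'M[R]_(m, n)) (F' : V -> 'M[R]_(n, q)) (p : V) :
  smooth_mx F p -> smooth_mx F' p -> smooth_mx (fun z => F z *m F' z) p.
Proof.
move=> sF sF' i j; under eq_fun do rewrite mxE.
by apply: smooth_near_sum => l; exact: smooth_nearM.
Qed.

Lemma smooth_mxT m n (F : V -> 'M[R]_(m, n)) (p : V) :
  smooth_mx F p -> smooth_mx (fun z => (F z)^T) p.
Proof. by move=> sF i j; under eq_fun do rewrite mxE. Qed.

Lemma smooth_det n (F : V -> 'M[R]_n) (p : V) :
  smooth_mx F p -> smooth_near (fun z => \det (F z) : R^o) p.
Proof.
move=> sF; apply: smooth_near_sum => s; apply: smooth_nearM.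
  exact: smooth_near_cst.
by apply: smooth_near_prod => i.
Qed.

(** Cramer's formula: near [p] the determinant stays nonzero by continuity, and the inverse is the
    adjugate divided by it. *)
Lemma smooth_invmx n (F : V -> 'M[R]_n) (p : V) :
  F p \in unitmx -> smooth_mx F p -> smooth_mx (fun z => invmx (F z)) p.
Proof.
move=> uF sF; have sdet := smooth_det sF.
have det0 : \det (F p) != 0 by rewrite -unitfE -unitmxE.
have udet : \near p, F p \in unitmx.
  have nz : \near p, \det (F p) != 0.
    exact: cvgr_neq0 _ (smooth_near_continuous sdet) det0.
  by apply: filterS nz => z; rewrite unitmxE unitfE.
apply: (@smooth_mx_ext _ _ (fun z => (\det (F z))^-1 *: \adj (F z))).
  by apply: filterS udet => z uz; rewrite /invmx uz.
move=> i j; under eq_fun do rewrite !mxE.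
apply: smooth_nearM; first exact: smooth_nearV.
apply: smooth_nearM; first exact: smooth_near_cst.
by apply: smooth_det => i' j'; under eq_fun do rewrite !mxE.
Qed.

End SmoothNear.

(** * Mean value estimates that are uniform in a parameter *)

Section StrictDifferentiability.
Context {R : realType}.

Lemma rV_norm_le n (A : 'rV[R]_n) (e : R) :
  0 <= e -> (forall i, `|A 0 i| <= e) -> `|A| <= e.
Proof.
move=> e0 Ae; rewrite [leLHS]/Num.Def.normr/= mx_normrE bigmax_le// => -[i j] _.
by rewrite ord1; exact: Ae.
Qed.

Lemma rV_coord_le n (A : 'rV[R]_n) i : `|A 0 i| <= `|A|.
Proof.
rewrite [leRHS]/Num.Def.normr/= mx_normrE.
exact: (le_bigmax _ (fun i : 'I_1 * 'I_n => `|A i.1 i.2|) (0, i)).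
Qed.

Lemma is_derive_mulr (l s : R) : is_derive s 1 (fun t : R => t * l) l.
Proof.
have d := is_deriveM (is_derive_id s (1 : R)) (is_derive_cst l s (1 : R)).
by apply: (is_derive_eq d); rewrite scaler0 add0r; exact: mulr1.
Qed.

Lemma is_derive_line (V W : normedModType R) (F : V -> W) (a v : V) (s : R) :
  derivable F (a + s *: v) v ->
  is_derive s 1 (fun t : R => F (a + t *: v)) ('D_v F (a + s *: v)).
Proof.
move=> dF.
have E : (fun t : R => t^-1 *: (((fun t : R => F (a + t *: v)) \o shift s) (t *: 1)
      - F (a + s *: v)))
  = (fun t => t^-1 *: ((F \o shift (a + s *: v)) (t *: v) - F (a + s *: v))).
  apply/funext => t /=; congr (_ *: (F _ - _)).
  by rewrite [t *: 1]mulr1 scalerDl addrCA.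
by split; rewrite /derivable /derive E.
Qed.

Lemma derive_lincomb (V W : normedModType R) (F : V -> W) (z : V)
    (I : finType) (c : I -> R) (v : I -> V) :
  differentiable F z ->
  'D_(\sum_i c i *: v i) F z = \sum_i c i *: 'D_(v i) F z.
Proof.
move=> dF; rewrite (deriveE _ dF) (raddf_sum ('d F z)).
by apply: eq_bigr => i _; rewrite (deriveE _ dF); exact: linearZ_LR.
Qed.

Lemma pair0_sum_delta (V : lmodType R) b (w : 'rV[R]_b) :
  (0 : V, w) = \sum_j w 0 j *: (0 : V, delta_mx 0 j : 'rV[R]_b).
Proof.
rewrite {1}[w]row_sum_delta.
have addE : {morph (fun w : 'rV[R]_b => (0 : V, w)) : x y / x + y}.
  by move=> x y; congr pair; rewrite addr0.
rewrite (big_morph _ addE (erefl _)); apply: eq_bigr => j _.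
by congr pair; rewrite scaler0.
Qed.

Lemma smooth_near_derive_ball (V W : normedModType R) (F : V -> W) (p : V)
    (I : finType) (v : I -> V) (e : R) :
  smooth_near F p -> 0 < e ->
  exists2 r, 0 < r & forall z, ball p r z ->
    differentiable F z /\ forall i, `|'D_(v i) F z - 'D_(v i) F p| <= e.
Proof.
move=> sF e0.
have nd : \near p, differentiable F p.
  by apply: filterS (smooth_near_nbhs sF) => z; exact: smooth_near_differentiable.
have nD : \forall z \near p, forall i, `|'D_(v i) F z - 'D_(v i) F p| <= e.
  apply: filter_forall => i.
  have cD : {for p, continuous ('D_(v i) F)}.
    by apply: smooth_near_continuous; exact: smooth_near_derive.
  exact: cvgr_distC_le cD _ e0.
by have [r r0 rP] := (nbhs_ballP _ _).1 (filterI nd nD); exists r.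
Qed.

(** The mean value theorem, coordinate by coordinate, along the segment from [y] to [y']: near [p]
    the derivative in a direction of the second factor differs little from its value at [p]. The
    radius works for all [u] at once, which is what repeated multiplication in a group chart
    requires. *)
Lemma strict_differentiable_snd (V : normedModType R) b c
    (F : V * 'rV[R]_b -> 'rV[R]_c) (p : V * 'rV[R]_b) (e : R) :
  smooth_near F p -> 0 < e ->
  exists2 r, 0 < r & forall u y y',
    ball p.1 r u -> ball p.2 r y -> ball p.2 r y' ->
    `|F (u, y') - F (u, y) - 'D_(0, y' - y) F p| <= e * `|y' - y|.
Proof.
(* Each of the [b] basis directions contributes at most [e'] times the norm of [w]; dividing by
   [b + 1] keeps the quotient meaningful when [b = 0]. *)
move=> sF e0; pose e' := e / b.+1%:R.
have e'0 : 0 < e' by rewrite divr_gt0.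
have [r r0 rP] :=
  smooth_near_derive_ball (fun j : 'I_b => (0, delta_mx 0 j)) sF e'0.
exists r => // u y y' pu py py'; set w := y' - y.
have seg s : s \in `[0, 1] -> ball p r (u, y + s *: w).
  rewrite in_itv /= => /andP[s0 s1]; split=> //=.
  move: py py'; rewrite -!ball_normE /= => py py'.
  have -> : p.2 - (y + s *: w) = (1 - s) *: (p.2 - y) + s *: (p.2 - y').
    by apply/rowP => i; rewrite !mxE; ring.
  rewrite (le_lt_trans (ler_normD _ _))// !normrZ (ger0_norm s0).
  rewrite ger0_norm ?subr_ge0//.
  have [->|s0'] := eqVneq s 0; first by rewrite subr0 mul1r mul0r addr0.
  have -> : r = (1 - s) * r + s * r by rewrite -mulrDl subrK mul1r.
  apply: ler_ltD; first by rewrite ler_wpM2l ?subr_ge0// ltW.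
  by rewrite ltr_pM2l // lt_neqAle eq_sym s0'.
have DF s : s \in `[0, 1] ->
    `|'D_(0, w) F (u, y + s *: w) - 'D_(0, w) F p| <= e * `|w|.
  move=> /seg/rP[dz Dz]; have [dp _] := rP _ (ballxx p r0).
  rewrite pair0_sum_delta !derive_lincomb//.
  rewrite -sumrB (le_trans (ler_norm_sum _ _ _))//.
  have -> : e * `|w| = \sum_(j < b.+1) (`|w| * e').
    rewrite sumr_const card_ord -mulr_natr -mulrA divfK ?pnatr_eq0//.
    by rewrite mulrC.
  rewrite big_ord_recr /=; apply: ler_wpDr; first by rewrite mulr_ge0// ltW.
  apply: ler_sum => j _; rewrite -scalerBr normrZ ler_pM ?rV_coord_le//.
apply: rV_norm_le; first by rewrite mulr_ge0// ltW.
move=> i; pose l : R := ('D_(0, w) F p) 0 i.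
(* The increment of [h] over the unit interval is the coordinate to be bounded, and its derivative
   is the deviation controlled by [DF]. *)
pose h (s : R) : R := F ((u, y) + s *: (0, w)) 0 i - s * l.
have lineE s : (u, y) + s *: ((0 : V), w) = (u, y + s *: w).
  by congr pair; rewrite /= scaler0 addr0.
have dh (s : R) : s \in `[0, 1] ->
    is_derive s 1 h (('D_(0, w) F (u, y + s *: w) - 'D_(0, w) F p) 0 i).
  move=> s01; have /seg/rP[dz _] := s01.
  have dv : derivable F ((u, y) + s *: (0, w)) (0, w).
    by rewrite lineE; exact: diff_derivable.
  have dvi := (derivable_mxP _ _ _).1 dv 0 i.
  have /(@is_derive_line _ R^o) d1 := dvi.
  have d2 : is_derive s 1 (fun t : R => t * l) l.
    exact: is_derive_mulr.
  have -> : ('D_(0, w) F (u, y + s *: w) - 'D_(0, w) F p) 0 i =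
      'D_(0, w) (fun x => F x 0 i : R^o) ((u, y) + s *: (0, w)) - l.
    by rewrite mxE [in X in _ + X]mxE -lineE (derive_mx dv) mxE.
  exact: (is_deriveB d1 d2).
have ch : {within `[0, 1], continuous h}.
  apply: derivable_within_continuous => s s01.
  exact: (@ex_derive _ _ _ _ _ _ _ (dh s s01)).
have [s s01 hE] := @MVT_segment R h _ 0 1 ler01
  (fun s s01 => dh s (subset_itv_oo_cc s01)) ch.
have -> : (F (u, y') - F (u, y) - 'D_(0, w) F p) 0 i = h 1 - h 0.
  rewrite /h !lineE !mxE scale1r scale0r addr0 mul1r mul0r subr0.
  by rewrite /w [y + _]addrC subrK addrAC.
rewrite hE subr0 mulr1 (le_trans (rV_coord_le _ _))//.
exact: DF.
Qed.

End StrictDifferentiability.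

(** * Restricting maps on a product to one factor *)

Section Slices.
Context {R : realType} {V V' W : normedModType R}.

(** The inclusion of a slice is the affine map [z |-> (0, z) + (a, 0)], so precomposition with
    affine maps applies. *)
Lemma smooth_near_slice2 (F : V * V' -> W) (a : V) (b : V') :
  smooth_near F (a, b) -> smooth_near (fun z => F (a, z)) b.
Proof.
have lin : linear (fun z : V' => (0 : V, z)).
  by move=> c x y; congr pair; rewrite /= scaler0 addr0.
pose lM := GRing.isLinear.Build _ _ _ _ _ lin.
pose L : {linear V' -> (V * V')%type} := HB.pack (fun z : V' => (0 : V, z)) lM.
have LE z : L z + (a, 0) = (a, z) by congr pair; rewrite /= ?add0r ?addr0.
have cL : continuous L by move=> z; apply: cvg_pair => //=; exact: cvg_cst.
rewrite -LE => /(smooth_near_affine cL).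
by under eq_fun do rewrite LE.
Qed.

Lemma smooth_near_slice1 (F : V * V' -> W) (a : V) (b : V') :
  smooth_near F (a, b) -> smooth_near (fun z => F (z, b)) a.
Proof.
have lin : linear (fun z : V => (z, 0 : V')).
  by move=> c x y; congr pair; rewrite /= scaler0 addr0.
pose lM := GRing.isLinear.Build _ _ _ _ _ lin.
pose L : {linear V -> (V * V')%type} := HB.pack (fun z : V => (z, 0 : V')) lM.
have LE z : L z + (0, b) = (z, b) by congr pair; rewrite /= ?add0r ?addr0.
have cL : continuous L by move=> z; apply: cvg_pair => //=; exact: cvg_cst.
rewrite -LE => /(smooth_near_affine cL).
by under eq_fun do rewrite LE.
Qed.

Lemma derive_slice1 (F : V * V' -> W) (a v : V) (b : V') :
  'D_v (fun z => F (z, b)) a = 'D_(v, 0) F (a, b).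
Proof.
rewrite /derive; suff -> : (fun h : R => h^-1 *: (((fun z => F (z, b)) \o shift a)
    (h *: v) - F (a, b))) = (fun h => h^-1 *: ((F \o shift (a, b)) (h *: (v, 0))
    - F (a, b))) by [].
apply/funext => h /=; congr (_ *: (F _ - _)).
by congr pair; rewrite /= scaler0 add0r.
Qed.

Lemma derive_slice2 (F : V * V' -> W) (a : V) (b v : V') :
  'D_v (fun z => F (a, z)) b = 'D_(0, v) F (a, b).
Proof.
rewrite /derive; suff -> : (fun h : R => h^-1 *: (((fun z => F (a, z)) \o shift b)
    (h *: v) - F (a, b))) = (fun h => h^-1 *: ((F \o shift (a, b)) (h *: (0, v))
    - F (a, b))) by [].
apply/funext => h /=; congr (_ *: (F _ - _)).
by congr pair; rewrite /= scaler0 add0r.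
Qed.

Lemma near_eq_diff (f g : V -> W) (x : V) :
  {near x, f =1 g} -> differentiable f x -> 'd f x =1 'd g x.
Proof.
move=> fg df v; rewrite -!deriveE//; first exact: near_eq_derive.
exact: near_eq_differentiable fg df.
Qed.

End Slices.

(** * Charts as local homeomorphisms *)

Section Charts.
Context {R : realType} {n : nat} {M : manifoldType R n}.
Implicit Types a x : M.

Lemma chart_invK a x : chart_dom a x -> chart_inv a (chart a x) = x.
Proof. by move=> ax; apply: chartK; rewrite inE. Qed.

Lemma chart_invK0 x : chart_inv x (chart x x) = x.
Proof. exact/chart_invK/mem_chart_dom. Qed.

Lemma nbhs_chart_dom a x : chart_dom a x -> nbhs x (chart_dom a).
Proof. by move=> ax; apply: open_nbhs_nbhs; split=> //; exact: open_chart_dom. Qed.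

Lemma chart_inv_cvg a x : chart_dom a x ->
  chart_inv a z @[z --> chart a x] --> x.
Proof.
move=> ax; rewrite -[X in _ --> X](chart_invK ax).
by apply: chart_inv_continuous; rewrite inE; exists x.
Qed.

Lemma chart_cvg a x : chart_dom a x -> chart a y @[y --> x] --> chart a x.
Proof. by move=> ax; apply: chart_continuous; rewrite inE. Qed.

Lemma near_chart_image a x : chart_dom a x ->
  \forall z \near chart a x, chart_dom a (chart_inv a z) /\
    chart a (chart_inv a z) = z.
Proof.
move=> ax; have : nbhs (chart a x) (chart a @` chart_dom a).
  apply: open_nbhs_nbhs; split; first exact: open_chart_image.
  by exists x.
by apply: filterS => _ [y ay <-]; rewrite chart_invK.
Qed.

End Charts.

(** * Differentials in arbitrary charts, and the chain rule *)

Section ChartDifferentials.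
Context {R : realType}.

Definition chart_map m n (M : manifoldType R m) (N : manifoldType R n)
  (a : M) (b : N) (f : M -> N) : 'rV[R]_m -> 'rV[R]_n :=
  chart b \o f \o chart_inv a.

(** The charts [a] and [b] may be centred elsewhere than at [x] and [f x]. Continuity of [f] is a
    separate clause because [chart b] has junk values outside its domain, so regularity of the
    coordinate expression alone does not confine [f] to that domain. *)
Definition mdifferentiable m n (M : manifoldType R m) (N : manifoldType R n)
    (a : M) (b : N) (f : M -> N) (x : M) : Prop :=
  [/\ chart_dom a x, chart_dom b (f x), {for x, continuous f} &
      differentiable (chart_map a b f) (chart a x)].

Definition mder m n (M : manifoldType R m) (N : manifoldType R n)
    (a : M) (b : N) (f : M -> N) (x : M) : 'rV[R]_m -> 'rV[R]_n :=
  'd (chart_map a b f) (chart a x).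

(** The intermediate chart cancels only where [f] takes values in its domain; continuity of [f]
    provides this near [x], and the chain rule in vector spaces does the rest. *)
Lemma mdifferentiable_comp m n p (M : manifoldType R m) (N : manifoldType R n)
    (P : manifoldType R p) (a : M) (b : N) (c : P) (f : M -> N) (g : N -> P) x :
  mdifferentiable a b f x -> mdifferentiable b c g (f x) ->
  mdifferentiable a c (g \o f) x /\
  mder a c (g \o f) x =1 mder b c g (f x) \o mder a b f x.
Proof.
move=> [ax bfx cf df] [_ cgx cg dg].
have E : {near chart a x,
    chart_map b c g \o chart_map a b f =1 chart_map a c (g \o f)}.
  have cfa : f (chart_inv a z) @[z --> chart a x] --> f x.
    by apply: (cvg_comp _ _ (chart_inv_cvg ax)); exact: cf.
  have nb : \forall z \near chart a x, chart_dom b (f (chart_inv a z)).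
    exact: cfa _ (nbhs_chart_dom bfx).
  apply: filterS nb => z bz.
  by rewrite /chart_map /= chart_invK.
have fxE : chart_map a b f (chart a x) = chart b (f x).
  by rewrite /chart_map /= chart_invK.
have dg' : differentiable (chart_map b c g) (chart_map a b f (chart a x)).
  by rewrite fxE.
have dgf := differentiable_comp df dg'.
split; first split=> //.
- exact: (continuous_comp cf cg).
- exact: near_eq_differentiable E dgf.
- move=> v; rewrite /mder -(near_eq_diff E dgf) (diff_comp df dg') /=.
  by rewrite fxE.
Qed.

(** In the charts [a] and [b] the identity is a transition map, so this is the compatibility of the
    atlas. *)
Lemma mdifferentiable_id n (M : manifoldType R n) (a b x : M) :
  chart_dom a x -> chart_dom b x -> mdifferentiable a b id x.
Proof.
move=> ax bx; split=> //.
have [+ _] := chart_compatible a b 1%N; apply.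
by exists x.
Qed.

Lemma mder_id n (M : manifoldType R n) (a x : M) :
  chart_dom a x -> mder a a id x =1 id.
Proof.
move=> ax v.
have E : {near chart a x, (id : 'rV[R]_n -> 'rV[R]_n) =1 chart_map a a id}.
  by apply: filterS (near_chart_image ax) => z [_ {1}<-].
rewrite /mder -(near_eq_diff E)// -deriveE//; exact: derive_id.
Qed.

Lemma mdifferentiable_slice2 m n p (M : manifoldType R m) (N : manifoldType R n)
    (P : manifoldType R p) (f : M -> N -> P) x y :
  smooth_map2 f -> mdifferentiable y (f x y) (f x) y.
Proof.
move=> [cf sf]; split; [exact: mem_chart_dom|exact: mem_chart_dom| |].
  apply: (@continuous_comp _ _ _ (fun y => (x, y)) (fun z => f z.1 z.2)).
    by apply: cvg_pair => //=; exact: cvg_cst.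
  exact: cf.
have /smooth_near_slice2/smooth_near_differentiable := sf x y.
by rewrite /= chart_invK0.
Qed.

Lemma mdifferentiable_slice1 m n p (M : manifoldType R m) (N : manifoldType R n)
    (P : manifoldType R p) (f : M -> N -> P) x y :
  smooth_map2 f -> mdifferentiable x (f x y) (f^~ y) x.
Proof.
move=> [cf sf]; split; [exact: mem_chart_dom|exact: mem_chart_dom| |].
  apply: (@continuous_comp _ _ _ (fun x => (x, y)) (fun z => f z.1 z.2)).
    by apply: cvg_pair => //=; exact: cvg_cst.
  exact: cf.
have /smooth_near_slice1/smooth_near_differentiable := sf x y.
by rewrite /= chart_invK0.
Qed.

Lemma tmap_toE m n (M : manifoldType R m) (N : manifoldType R n)
    (f : M -> N) (x : M) (y : N) v :
  tmap_to f x y v = mder x y f x v.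
Proof. by rewrite /tmap_to lfunE. Qed.

End ChartDifferentials.

(** * Differentials of the action and infinitesimal generators *)

Section ActionDifferentials.
Context {R : realType} {n k : nat} {M : manifoldType R n} {G : lieGroupType R k}.
Variable Phi : G -> M -> M.
Hypothesis actionPhi : smooth_left_action Phi.

Let act1 x : Phi 1%g x = x. Proof. by case: actionPhi. Qed.
Let actM a b x : Phi (a * b)%g x = Phi a (Phi b x).
Proof. by case: actionPhi. Qed.
Let smooth_act : smooth_map2 Phi. Proof. by case: actionPhi. Qed.

Lemma mdifferentiable_orbit x : mdifferentiable 1%g x (Phi^~ x) 1%g.
Proof. by have := mdifferentiable_slice1 1%g x smooth_act; rewrite act1. Qed.

Lemma mdifferentiable_act h x y : Phi h x = y -> mdifferentiable x y (Phi h) x.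
Proof. by move=> <-; exact: mdifferentiable_slice2. Qed.

Lemma generatorE xi x :
  infinitesimal_generator Phi xi x = mder 1%g x (Phi^~ x) 1%g xi.
Proof. exact: tmap_toE. Qed.

Lemma tmap_act_inv h x y : Phi h x = y ->
  cancel (tmap_to (Phi h^-1%g) y x) (tmap_to (Phi h) x y).
Proof.
move=> hxy v; have hyx : Phi h^-1%g y = x by rewrite -hxy -actM mulVg act1.
have d1 := mdifferentiable_act hyx.
have d2 : mdifferentiable x y (Phi h) (Phi h^-1%g y).
  by rewrite hyx; exact: mdifferentiable_act.
have [_ E] := mdifferentiable_comp d1 d2.
rewrite !tmap_toE -{2}hyx -[LHS](E v).
rewrite (_ : Phi h \o Phi h^-1%g = id); first exact/mder_id/mem_chart_dom.
by apply/funext => z /=; rewrite -actM mulgV act1.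
Qed.

(** Differentiate [h (a x) = (h a h^-1) (h x)] at [a = 1]: the vector [xi'] is the image of [xi]
    under the derivative of conjugation by [h], that is, under the adjoint action. *)
Lemma tmap_generator h x y (xi : tangent (1%g : G)) : Phi h x = y ->
  exists xi', tmap_to (Phi h) x y (infinitesimal_generator Phi xi x) =
    infinitesimal_generator Phi xi' y.
Proof.
move=> hxy.
have dL : mdifferentiable 1%g h (fun a : G => (h * a)%g) 1%g.
  have := @mdifferentiable_slice2 _ _ _ _ _ _ _ _ h 1%g (@smooth_mulg R k G).
  by rewrite mulg1.
have dR : mdifferentiable h 1%g (fun a : G => (a * h^-1)%g) (h * 1)%g.
  have := @mdifferentiable_slice1 _ _ _ _ _ _ _ _ h h^-1%g (@smooth_mulg R k G).
  by rewrite mulgV mulg1.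
have [dC _] := mdifferentiable_comp dL dR.
set conj := _ \o _ in dC.
have conj1 : conj 1%g = 1%g by rewrite /conj /= mulg1 mulgV.
have dO : mdifferentiable 1%g y (Phi^~ y) (conj 1%g).
  by rewrite conj1; exact: mdifferentiable_orbit.
have [_ E1] := mdifferentiable_comp dC dO.
have dA : mdifferentiable x y (Phi h) (Phi 1%g x).
  by rewrite act1; exact: mdifferentiable_act.
have [_ E2] := mdifferentiable_comp (mdifferentiable_orbit x) dA.
exists (mder 1%g 1%g conj 1%g xi).
have L1 := E2 xi; rewrite act1 in L1.
have L2 := E1 xi; rewrite conj1 in L2.
have fE : Phi h \o Phi^~ x = Phi^~ y \o conj.
  by apply/funext => a; rewrite /conj /= -hxy -!actM -mulgA mulVg mulg1.
rewrite tmap_toE !generatorE.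
exact: (etrans (esym L1) (etrans (congr1 (fun F => mder 1%g y F 1%g xi) fE) L2)).
Qed.

(** Passing from the preferred chart at the moving point to [chart x0] is absorbed by the chain
    rule. What remains is a partial derivative, in the group direction, of one fixed smooth map;
    hence generators are smooth fields. *)
Lemma vf_rep_generator (xi : tangent (1%g : G)) x0 :
  \forall z \near chart x0 x0,
    vf_rep (infinitesimal_generator Phi xi) x0 z =
    'D_(xi, 0) (fun w : 'rV[R]_k * 'rV[R]_n =>
       chart x0 (Phi (chart_inv (1%g : G) w.1) (chart_inv x0 w.2)))
      (chart (1%g : G) 1%g, z).
Proof.
apply: filterS (near_chart_image (mem_chart_dom x0)) => z [dz zE].
rewrite /vf_rep -/(chart_map _ _ id); set y := chart_inv x0 z.
have d1 := mdifferentiable_orbit y.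
have d2 : mdifferentiable y x0 id (Phi 1%g y).
  by rewrite act1; apply: mdifferentiable_id => //; exact: mem_chart_dom.
have [[_ _ _ d12] E] := mdifferentiable_comp d1 d2.
rewrite generatorE.
have -> : 'd (chart x0 \o chart_inv y) (chart y y) =
    mder y x0 id (Phi 1%g y) :> (_ -> _).
  by rewrite act1.
apply: (etrans (esym (E xi))); rewrite /mder -(deriveE _ d12).
by rewrite -derive_slice1.
Qed.

Lemma smooth_vf_generator (xi : tangent (1%g : G)) :
  smooth_vf (infinitesimal_generator Phi xi).
Proof.
move=> x _; have := vf_rep_generator xi x => E.
apply: (@smooth_near_ext _ _ _ (fun z => 'D_(xi, 0) (fun w : 'rV[R]_k * 'rV[R]_n =>
       chart x (Phi (chart_inv (1%g : G) w.1) (chart_inv x w.2)))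
      (chart (1%g : G) 1%g, z))).
  by apply: filterS E.
apply: (@smooth_near_slice2 _ _ _ _ ('D_(xi, 0) _)).
apply: smooth_near_derive.
by have [_ /(_ 1%g x)] := smooth_act; rewrite act1.
Qed.

End ActionDifferentials.

(** * Strict estimates around a unit law *)

Section StrictEstimates.
Context {R : realType}.

Lemma continuous_dist (T : topologicalType) (W : normedModType R) (f : T -> W)
    (a : T) (c : W) :
  {for a, continuous f} -> {for a, continuous (fun u => `|f u - c|)}.
Proof.
move=> cf; have h : f u - c @[u --> a] --> f a - c.
  by apply: cvgB => //; exact: cvg_cst.
exact: cvg_norm h.
Qed.

(** Freezing the first variable at [p.1] gives the identity near [p.2], so the partial derivative at
    [p] in the second variable is the identity. *)
Lemma strict_near_id_snd (V : normedModType R) b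
    (F : V * 'rV[R]_b -> 'rV[R]_b) (p : V * 'rV[R]_b) (e : R) :
  smooth_near F p -> (\forall y \near p.2, F (p.1, y) = y) -> 0 < e ->
  exists2 r, 0 < r & forall u y y',
    ball p.1 r u -> ball p.2 r y -> ball p.2 r y' ->
    `|F (u, y') - F (u, y) - (y' - y)| <= e * `|y' - y|.
Proof.
move=> sF Fid e0; have [r r0 rP] := strict_differentiable_snd sF e0.
exists r => // u y y' pu py py'; have := rP u y y' pu py py'.
suff -> : 'D_(0, y' - y) F p = y' - y by [].
move: sF Fid; rewrite [p]surjective_pairing /= => sF Fid.
rewrite -derive_slice2 -[RHS](derive_id p.2 (y' - y)).
exact: near_eq_derive.
Qed.

Lemma chart_inv_cvg2 m n p (M : manifoldType R m) (N : manifoldType R n)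
    (P : manifoldType R p) (f : M -> N -> P) (x : M) (y : N) :
  continuous (fun z : M * N => f z.1 z.2) ->
  f (chart_inv x z.1) (chart_inv y z.2) @[z --> (chart x x, chart y y)]
    --> f x y.
Proof.
move=> cf.
have c1 : (chart_inv x z.1, chart_inv y z.2) @[z --> (chart x x, chart y y)]
    --> (x, y).
  apply: cvg_pair => /=.
    apply: (cvg_comp _ _ cvg_fst); exact: chart_inv_cvg (mem_chart_dom x).
  apply: (cvg_comp _ _ cvg_snd); exact: chart_inv_cvg (mem_chart_dom y).
exact: (cvg_comp _ _ c1 (cf (x, y))).
Qed.

End StrictEstimates.

(** * Injectivity of the infinitesimal action of a free action *)

Section InjectiveGenerators.
Context {R : realType} {n k : nat} {M : manifoldType R n} {G : lieGroupType R k}.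
Variable Phi : G -> M -> M.
Hypothesis actionPhi : smooth_left_action Phi.
Hypothesis freePhi : free_action Phi.

Let act1 x : Phi 1%g x = x. Proof. by case: actionPhi. Qed.
Let actM a b x : Phi (a * b)%g x = Phi a (Phi b x).
Proof. by case: actionPhi. Qed.
Let smooth_act : smooth_map2 Phi. Proof. by case: actionPhi. Qed.
Let e : G := 1%g.
Let p0 : 'rV[R]_k := chart e e.

Let m (z : 'rV[R]_k * 'rV[R]_k) : 'rV[R]_k :=
  chart e (chart_inv e z.1 * chart_inv e z.2)%g.

Let phi (x : M) (z : 'rV[R]_k * 'rV[R]_n) : 'rV[R]_n :=
  chart x (Phi (chart_inv e z.1) (chart_inv x z.2)).

Let smooth_m : smooth_near m (p0, p0).
Proof. by have [_ /(_ e e)] := @smooth_mulg R k G; rewrite mulg1. Qed.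

Let smooth_phi x : smooth_near (phi x) (p0, chart x x).
Proof. by have [_ /(_ e x)] := smooth_act; rewrite act1. Qed.

Let chart_group_ball : exists2 r, 0 < r & forall u, ball p0 r u ->
  chart_dom e (chart_inv e u) /\ chart e (chart_inv e u) = u.
Proof.
by have /nbhs_ballP[r r0 rP] := near_chart_image (mem_chart_dom e); exists r.
Qed.

(** As [m (p0, w) = w], right multiplication by an element near the identity is, in coordinates,
    almost translation by [w - p0], uniformly in [u]. *)
Let m_ball : exists2 r, 0 < r & forall u w, ball p0 r u -> ball p0 r w ->
  chart_inv e (m (u, w)) = (chart_inv e u * chart_inv e w)%g /\
  `|m (u, w) - u - (w - p0)| <= 4^-1 * `|w - p0|.
Proof.
have id1 : \forall y \near (p0, p0).2, m ((p0, p0).1, y) = y.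
  apply: filterS (near_chart_image (mem_chart_dom e)) => y [dy yE].
  by rewrite /m /= chart_invK0 mul1g.
have q0 : 0 < 4^-1 :> R by rewrite invr_gt0.
have [r1 r10 r1P] := strict_near_id_snd smooth_m id1 q0.
have [r2 r20 r2P] := chart_group_ball.
have : \forall z \near (p0, p0), chart_dom e (chart_inv e z.1 * chart_inv e z.2)%g.
  have [cm _] := @smooth_mulg R k G.
  have cvm := @chart_inv_cvg2 _ _ _ _ _ _ _ _ e e cm.
  apply: cvm; apply: nbhs_chart_dom; rewrite mulg1; exact: mem_chart_dom.
move=> /nbhs_ballP[r3 /= r30 r3P].
exists (Num.min r1 (Num.min r2 r3)) => [|u w]; first by rewrite !lt_min r10 r20.
move=> bu bw.
have le1 : Num.min r1 (Num.min r2 r3) <= r1 by rewrite ge_min lexx.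
have le2 : Num.min r1 (Num.min r2 r3) <= r2 by rewrite !ge_min lexx orbT.
have le3 : Num.min r1 (Num.min r2 r3) <= r3 by rewrite !ge_min lexx !orbT.
split.
  rewrite /m chart_invK//; apply: (r3P (u, w)).
  by split; [exact: le_ball bu|exact: le_ball bw].
have [du uE] := r2P _ (le_ball le2 bu).
have := r1P u p0 w (le_ball le1 bu) (ballxx _ r10) (le_ball le1 bw).
by rewrite {2}/m /= chart_invK0 mulg1 uE.
Qed.

(** The identity acts trivially, so the strict estimate with error 1 bounds by 2 the expansion of
    distances from [x] under all group elements near the identity. *)
Let phi_ball x : exists2 r, 0 < r & forall u, ball p0 r u ->
  [/\ chart_dom x (Phi (chart_inv e u) x),
      {for u, continuous (fun u => phi x (u, chart x x))} &
      forall y, ball (chart x x) r y ->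
      `|phi x (u, y) - phi x (u, chart x x)| <= 2 * `|y - chart x x|].
Proof.
have id1 : \forall y \near (p0, chart x x).2, phi x ((p0, chart x x).1, y) = y.
  apply: filterS (near_chart_image (mem_chart_dom x)) => y [dy yE].
  by rewrite /phi /= chart_invK0 act1.
have [r1 r10 r1P] := strict_near_id_snd (smooth_phi x) id1 ltr01.
have n2 : \near p0, chart_dom x (Phi (chart_inv e p0) x).
  have [_ _ cO _] := mdifferentiable_orbit actionPhi x.
  have cv : Phi (chart_inv e u) x @[u --> p0] --> Phi e x.
    exact: (@cvg_comp _ _ _ _ (Phi^~ x) _ _ _ (chart_inv_cvg (mem_chart_dom e)) cO).
  apply: cv; apply: nbhs_chart_dom; rewrite act1; exact: mem_chart_dom.
have n3 := smooth_near_nbhs (smooth_near_slice1 (smooth_phi x)).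
have [r2 /= r20 r2P] := (nbhs_ballP _ _).1 (filterI n2 n3).
have le1 : Num.min r1 r2 <= r1 by rewrite ge_min lexx.
have le2 : Num.min r1 r2 <= r2 by rewrite ge_min lexx orbT.
exists (Num.min r1 r2) => [|u bu]; first by rewrite lt_min r10.
have [d3 s3] := r2P _ (le_ball le2 bu).
split=> // [|y by_]; first exact: smooth_near_continuous.
have := r1P u (chart x x) y (le_ball le1 bu) (ballxx _ r10) (le_ball le1 by_).
rewrite mul1r => le; rewrite -[X in `|X|](subrK (y - chart x x)).
rewrite (le_trans (ler_normD _ _))// mulrDl mul1r.
by rewrite lerD.
Qed.

(** On a compact annulus around the identity the displacement of [x] has a minimum [delta], positive
    by freeness. If the generator vanished, a power of a small element in the direction [xi] would
    reach the annulus with displacement at most [delta / 2]. *)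
Lemma generator_inj x (xi : tangent (1%g : G)) :
  infinitesimal_generator Phi xi x = 0 -> xi = 0.
Proof.
move=> gen0; apply: contrapT => /eqP xi0.
set q := chart x x.
pose f u := phi x (u, q).
have fE u : f u = chart x (Phi (chart_inv e u) x).
  by rewrite /f /phi /= chart_invK0.
have fE' : f = chart_map e x (Phi^~ x) by apply/funext => u; rewrite fE.
have fp0 : f p0 = q by rewrite fE chart_invK0 act1.
have df : differentiable f p0.
  exact: smooth_near_differentiable (smooth_near_slice1 (smooth_phi x)).
pose v : 'rV[R]_k := `|xi : 'rV[R]_k|^-1 *: (xi : 'rV[R]_k).
have v1 : `|v| = 1 by rewrite normrZ normfV normr_id mulVf ?normr_eq0.
have Dv0 : 'D_v f p0 = 0.
  rewrite (deriveE _ df) (linearZ_LR ('d f p0)) /=.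
  have -> : 'd f p0 xi = 0 by rewrite -gen0 generatorE /mder -fE'.
  by rewrite scaler0.
(* The derivative of [f] along [v] vanishes, so the element with coordinates [t *: v + p0] displaces
   [x] by [o(t)]. *)
have small eta : 0 < eta -> \forall t \near (0 : R)^',
    `|f (t *: v + p0) - q| <= eta * `|t|.
  move=> eta0; have cv : derivable f p0 v by exact: diff_derivable.
  have {cv} : (h^-1 *: ((f \o shift p0) (h *: v) - f p0)) @[h --> 0^'] --> (0 : 'rV[R]_n).
    by rewrite -Dv0; exact: cv.
  move=> /cvgr0_norm_le/(_ eta eta0) cv; near=> t.
  have t0 : t != 0 by near: t; exact: nbhs_dnbhs_neq.
  have : `|t^-1 *: ((f \o shift p0) (t *: v) - f p0)| <= eta by near: t.
  by rewrite normrZ normfV fp0 /= mulrC ler_pdivrMr ?normr_gt0.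
have [r1 r10 r1P] := chart_group_ball.
have [r2 r20 r2P] := m_ball.
have [r3 r30 r3P] := phi_ball x.
pose r := Num.min r1 (Num.min r2 r3).
have le1 : r <= r1 by rewrite ge_min lexx.
have le2 : r <= r2 by rewrite !ge_min lexx orbT.
have le3 : r <= r3 by rewrite !ge_min lexx !orbT.
have r0 : 0 < r by rewrite !lt_min r10 r20.
have ballr u : `|u - p0| < r -> ball p0 r u by rewrite -ball_normE /= distrC.
pose rho := r / 2.
have rho0 : 0 < rho by rewrite divr_gt0.
(* The margins absorb the relative error [4^-1] of [m_ball] around the target [rho *: v]; since
   [rho = r / 2], the annulus lies in the ball of radius [r]. *)
pose K := (fun u : 'rV[R]_k => `|u - p0|) @^-1` `[3 / 4 * rho, 5 / 4 * rho]%classic.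
have KE u : K u = (3 / 4 * rho <= `|u - p0| <= 5 / 4 * rho) :> Prop.
  by rewrite /K /= in_itv.
have Kr u : K u -> ball p0 r u.
  by rewrite KE => /andP[_ le]; apply: ballr; rewrite /rho in le; lra.
have cdist : continuous (fun u : 'rV[R]_k => `|u - p0|).
  move=> u; apply: (@continuous_dist _ _ _ id); exact: cvg_id.
have cK : compact K.
  apply: bounded_closed_compact; last first.
    by apply: closed_comp => [u _|]; [exact: cdist|exact: interval_closed].
  exists (`|p0| + 5 / 4 * rho); split; first exact: num_real.
  move=> C ltC u; rewrite KE => /andP[_ le].
  rewrite /= -[u](subrK p0) (le_trans (ler_normD _ _))//.
  by apply: le_trans (ltW ltC); rewrite addrC lerD2l.
have K0 : K !=set0.
  exists (rho *: v + p0); rewrite KE addrK normrZ v1 mulr1 gtr0_norm//.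
  by apply/andP; split; lra.
have cfK : {within K, continuous (fun u => `|f u - q|)}.
  apply: continuous_in_subspaceT => u; rewrite inE => /Kr/(le_ball le3)/r3P[_ cf _].
  exact: continuous_dist.
have [c] := EVT_min_rV K0 cK cfK.
rewrite inE => Kc cmin; set delta := `|f c - q| in cmin.
(* A zero minimum would give a group element fixing [x], hence the identity, whose coordinates [p0]
   lie outside the annulus. *)
have delta0 : 0 < delta.
  rewrite normr_gt0 subr_eq0; apply/eqP => fcq.
  have [dc _ _] := r3P _ (le_ball le3 (Kr _ Kc)).
  have [_ cE] := r1P _ (le_ball le1 (Kr _ Kc)).
  have : Phi (chart_inv e c) x = x.
    by rewrite -[LHS](chart_invK dc) -fE fcq chart_invK0.
  move=> /freePhi c1; move: Kc; rewrite KE -cE c1 subrr normr0 => /andP[].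
  by move=> + _; rewrite leNgt mulr_gt0.
pose eta := delta / (4 * rho).
have eta0 : 0 < eta by rewrite divr_gt0// mulr_gt0.
have etaE : eta * rho = delta / 4.
  by rewrite /eta; field; rewrite gt_eqF.
(* The bound [r / eta] on [t] ensures that the displaced point stays in the ball where [phi_ball]
   applies. *)
have small2 : \forall t \near (0 : R)^',
    `|f (t *: v + p0) - q| <= eta * `|t| /\ `|t| < r / eta.
  have nt : \forall t \near (0 : R)^', `|t| < r / eta.
    by apply: dnbhs0_lt; rewrite divr_gt0.
  by apply: filterS2 (small eta eta0) nt => t; split.
have /nbhs_ballP[s /= s0 sP] := small2.
(* With this [N] the step [eps] is below [s], and [N + 1] steps add up to exactly [rho]. *)
pose N := Num.truncn (rho / s).
pose eps := rho / N.+1%:R.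
have eps0 : 0 < eps by rewrite divr_gt0.
have epsN : N.+1%:R * eps = rho by rewrite /eps mulrC divfK// pnatr_eq0.
have epss : eps < s.
  rewrite /eps ltr_pdivrMr// mulrC -ltr_pdivrMr//; exact: truncnS_gt.
have [fw epsr] : `|f (eps *: v + p0) - q| <= eta * eps /\ eps < r / eta.
  have [] := sP eps; last by rewrite gtr0_norm.
    by rewrite -ball_normE /= sub0r normrN gtr0_norm.
  by rewrite /= gt_eqF.
set w := eps *: v + p0 in fw.
have wp0 : w - p0 = eps *: v by rewrite /w addrK.
have nwp0 : `|w - p0| = eps by rewrite wp0 normrZ v1 mulr1 gtr0_norm.
have eps_rho : eps <= rho.
  by rewrite -epsN ler_peMl ?ler1n// ltW.
have bw : ball p0 r w by apply: ballr; rewrite nwp0 /rho in eps_rho *; lra.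
have bfw : ball q r (f w).
  rewrite -ball_normE /= distrC (le_lt_trans fw)// mulrC -ltr_pdivlMr//.
pose u j := iter j (fun u => m (u, w)) p0.
(* Each new factor [w] adds [eps *: v] to the coordinates up to [eps / 4], and adds to the
   displacement of [x] at most twice that of [w], by the Lipschitz bound. Both errors thus grow
   linearly in [j]. *)
have main j : (j <= N.+1)%N ->
    `|u j - p0 - (j%:R * eps) *: v| <= 4^-1 * (j%:R * eps) /\
    `|f (u j) - q| <= 2 * eta * (j%:R * eps).
  elim: j => [|j IH] jN.
    by rewrite /= mul0r scale0r !subrr normr0 fp0 subrr normr0 !mulr0.
  have [IH1 IH2] := IH (ltnW jN).
  have jrho : j%:R * eps <= rho.
    by rewrite -epsN ler_pM2r// ler_nat ltnW.
  have j0 : 0 <= j%:R * eps by rewrite mulr_ge0// ltW.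
  have bu : ball p0 r (u j).
    apply: ballr; rewrite -[u j - p0](subrK ((j%:R * eps) *: v)).
    rewrite (le_lt_trans (ler_normD _ _))// normrZ v1 mulr1 ger0_norm//.
    rewrite /rho in jrho; lra.
  have [mE mle] := r2P _ _ (le_ball le2 bu) (le_ball le2 bw).
  have uS : u j.+1 = m (u j, w) by [].
  rewrite uS -natr1 mulrDl mul1r; split.
    have -> : m (u j, w) - p0 - (j%:R * eps + eps) *: v =
        (m (u j, w) - u j - (w - p0)) + (u j - p0 - (j%:R * eps) *: v).
      by rewrite wp0; apply/rowP => i; rewrite !mxE; ring.
    rewrite (le_trans (ler_normD _ _))//; rewrite nwp0 in mle; lra.
  have [dw _ _] := r3P _ (le_ball le3 bw).
  have [_ _ /(_ _ (le_ball le3 bfw)) lip] := r3P _ (le_ball le3 bu).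
  have fS : f (m (u j, w)) = phi x (u j, f w).
    by rewrite fE mE actM /phi /= fE chart_invK.
  rewrite fS -[_ - q](subrKA (f (u j))) (le_trans (ler_normD _ _))//.
  rewrite -/q -/(f (u j)) in lip; lra.
have [uK fK] := main _ (leqnn _); rewrite epsN in uK fK.
have KuN : K (u N.+1).
  have d1 : `|u N.+1 - p0| <= 5 / 4 * rho.
    rewrite -[u _ - p0](subrK (rho *: v)) (le_trans (ler_normD _ _))//.
    rewrite normrZ v1 mulr1 gtr0_norm//; lra.
  rewrite KE d1 andbT.
  have : rho = `|rho *: v| by rewrite normrZ v1 mulr1 gtr0_norm.
  have := ler_normB (u N.+1 - p0) (u N.+1 - p0 - rho *: v).
  rewrite opprB addrC subrK => le1' rE; rewrite -rE in le1'; lra.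
have := cmin (u N.+1); rewrite inE => /(_ KuN) le.
rewrite -mulrA etaE in fK.
suff : delta <= 0 by rewrite leNgt delta0.
have := le_trans le fK; lra.
Unshelve. all: by end_near. Qed.

End InjectiveGenerators.

(** * First order expansions and operator bounds *)

Section NormBounds.
Context {R : realType}.

Lemma differentiable_near (V W : normedModType R) (f : V -> W) (x : V) (e : R) :
  differentiable f x -> 0 < e ->
  \forall z \near x, `|f z - f x - 'd f x (z - x)| <= e * `|z - x|.
Proof.
move=> /diff_locallyP[_ /eqaddoP ff] e0.
have fe : \forall h \near (0 : V),
    `|(f \o shift x - (cst (f x) + 'd f x)) h| <= e * `|h|.
  by exact: ff.
rewrite (near_shift 0 x); apply: filterS fe => h /=.
by rewrite subr0 !fctE /= addrK opprD addrA.
Qed.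

Lemma mulmx_norm_bound m n (A : 'M[R]_(m, n)) :
  exists2 C, 0 < C & forall u : 'rV[R]_m, `|u *m A| <= C * `|u|.
Proof.
(* The summand 1 keeps [C] positive for a zero matrix, so that it can be divided by. *)
pose C := 1 + \sum_i \sum_j `|A i j|.
have C0 : 0 < C.
  by rewrite ltr_pwDl// sumr_ge0// => i _; rewrite sumr_ge0.
exists C => // u; apply: rV_norm_le => [|j]; first by rewrite mulr_ge0// ltW.
rewrite mxE (le_trans (ler_norm_sum _ _ _))// /C mulrDl.
apply: ler_wpDl; first by rewrite mul1r.
rewrite mulr_suml; apply: ler_sum => i _; rewrite normrM mulrC.
apply: ler_pM => //; last exact: rV_coord_le.
by rewrite (bigD1 j)//= lerDl sumr_ge0.
Qed.

End NormBounds.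

(** * The tangent space of an orbit consists of the generators *)

Section VerticalSpace.
Context {R : realType} {n k : nat} {M : manifoldType R n} {G : lieGroupType R k}.
Variable Phi : G -> M -> M.
Hypothesis actionPhi : smooth_left_action Phi.
Hypothesis freePhi : free_action Phi.
Hypothesis properPhi : proper_action Phi.

Let act1 x : Phi 1%g x = x. Proof. by case: actionPhi. Qed.
Let smooth_act : smooth_map2 Phi. Proof. by case: actionPhi. Qed.

(** The lift is chosen pointwise. Were it to stay outside a neighbourhood of the identity for times
    accumulating at 0, properness over the compact set of pairs of a curve point and [x] would give
    a cluster point [a]; continuity and the Hausdorff property force [a x = x], so [a = 1] by
    freeness, a contradiction. *)
Lemma orbit_curve_lift (c : R -> M) x :
  c 0 = x -> (\forall t \near (0 : R), {for t, continuous c}) ->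
  (\forall t \near (0 : R), range (Phi^~ x) (c t)) ->
  exists h : R -> G, (\forall t \near (0 : R), Phi (h t) x = c t) /\
    h t @[t --> (0 : R)] --> (1%g : G).
Proof.
move=> c0 cc rc.
pose h t := xget (1%g : G) [set a | Phi a x = c t].
have hP : \forall t \near (0 : R), Phi (h t) x = c t.
  apply: filterS rc => t [a _ ac].
  by apply: (@xgetPex _ 1%g [set a | Phi a x = c t]); exists a.
exists h; split=> // O nO.
have /nbhs_ballP[r /= r0 rP] := cc.
pose I := `[- (r / 2), r / 2]%classic : set R.
have Ir t : I t -> ball 0 r t.
  rewrite /I /= in_itv /= => /andP[t1 t2].
  rewrite -ball_normE /= sub0r normrN ltr_norml; apply/andP; split; lra.
have nI : \forall t \near (0 : R), I t.
  apply/nbhs_ballP; exists (r / 2); first by rewrite /= divr_gt0.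
  move=> t; rewrite -ball_normE /= sub0r normrN ltr_norml => /andP[t1 t2].
  by rewrite /I /= in_itv /= !ltW.
have cI : compact (c @` I).
  apply: continuous_compact; last exact: segment_compact.
  by apply: continuous_in_subspaceT => t; rewrite inE => /Ir/rP.
have := properPhi (compact_setX cI (@compact_set1 _ x)).
set P := (X in compact X) => cP.
apply: contrapT => notO.
(* The filter of bad times near 0; it is proper exactly because the convergence is assumed to
   fail. *)
pose F' := within [set t | ~ O (h t)] (nbhs (0 : R)).
have FF' : ProperFilter F'.
  split; last exact: within_filter.
  move=> F0; have F0' : \forall t \near (0 : R), ~ O (h t) -> False by exact: F0.
  have nO' : \forall t \near (0 : R), O (h t).
    by apply: filterS F0' => t hh; apply: contrapT => /hh.
  exact: notO.
pose H t := (h t, x).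
have F'0 : F' `=>` nbhs (0 : R) by exact: cvg_within.
have FP : (H @ F') P.
  apply: F'0; rewrite /=; apply: filterS2 hP nI => t ht It.
  by rewrite /P /H /=; split=> //=; exists t.
have [[a b] [Pab clab]] := cP _ (fmap_proper_filter H FF') FP.
have bx : b = x by case: Pab.
have cS : (fun z : G * M => Phi z.1 z.2) z @[z --> (a, x)] --> Phi a x.
  by case: smooth_act => + _ => /(_ (a, x)).
have hx : cluster (nbhs x) (Phi a x).
  move=> A B nA nB.
  have FA : (H @ F') [set z | A (Phi z.1 z.2)].
    apply: F'0; rewrite /=.
    have cA : \forall t \near (0 : R), A (c t).
      by have := nbhs_singleton cc; rewrite /prop_for /continuous_at c0; exact.
    by apply: filterS2 hP cA => t /= ->.
  have nB' : nbhs (a, b) [set z | B (Phi z.1 z.2)] by rewrite bx; exact: cS.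
  have [z [zA zB]] := clab _ _ FA nB'.
  by exists (Phi z.1 z.2).
have a1 : a = 1%g.
  by apply: freePhi; apply: esym; exact: (@manifold_hausdorff R n M _ _ hx).
have FO : (H @ F') [set z | ~ O z.1].
  by rewrite /F' /=; apply: withinT; exact: nbhs_filter.
have nO' : nbhs (a, b) [set z : G * M | O z.1].
  by rewrite a1; exact: (cvg_fst nO).
by have [z [zO]] := clab _ _ FO nO'.
Qed.

(** The curve in the group is a straight line through the identity in its chart, with direction
    [xi]; its image under the orbit map has the generator as velocity at 0. *)
Lemma generator_tangent_to x (xi : tangent (1%g : G)) :
  vertical Phi x (infinitesimal_generator Phi xi x).
Proof.
set e := (1%g : G); set p0 := chart e e.
pose xi' : 'rV[R]_k := xi.
pose l (t : R) : 'rV[R]_k := t *: xi' + p0.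
pose f u := chart x (Phi (chart_inv e u) x).
pose c t := Phi (chart_inv e (l t)) x.
have l0 : l 0 = p0 by rewrite /l scale0r add0r.
have cl : continuous l.
  move=> t; suff : s *: xi' + p0 @[s --> t] --> t *: xi' + p0 by [].
  by apply: cvgD; [apply: cvgZr_tmp; exact: cvg_id|exact: cvg_cst].
have sf : smooth_near f p0.
  have [_ /(_ e x)] := smooth_act; rewrite act1 => /smooth_near_slice1.
  by rewrite /= chart_invK0.
have df : differentiable f p0 by exact: smooth_near_differentiable.
have lin : linear (fun t : R^o => t *: xi').
  by move=> a u v; rewrite scalerDl scalerA.
pose lM := GRing.isLinear.Build _ _ _ _ _ lin.
pose L : {linear R^o -> 'rV[R]_k} := HB.pack (fun t : R^o => t *: xi') lM.
exists c; last by near=> t; exists (chart_inv e (l t)).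
split.
- by rewrite /c l0 chart_invK0 act1.
(* Continuity of [chart_inv] is only available on the image of the chart, which the line leaves for
   large [t]. *)
- have nl : \forall t \near (0 : R), (chart e @` chart_dom e) (l t).
    apply: cl; rewrite l0; apply: open_nbhs_nbhs; split.
      exact: open_chart_image.
    by exists e => //; exact: mem_chart_dom.
  apply: filterS nl => t lt.
  apply: (@continuous_comp _ _ _ l (Phi^~ x \o chart_inv e)); first exact: cl.
  apply: (@continuous_comp _ _ _ (chart_inv e) (Phi^~ x)).
    by apply: chart_inv_continuous; rewrite inE.
  apply: (@continuous_comp _ _ _ (fun a => (a, x)) (fun z => Phi z.1 z.2)).
    by apply: cvg_pair => //=; exact: cvg_cst.
  by case: smooth_act => + _; apply.
- have := @smooth_near_affine R _ R^o _ f L p0 (0 : R^o) (@scalel_continuous _ _ _).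
  by apply; rewrite /= -/(l 0) l0.
- rewrite derive1E generatorE /mder -[chart_map _ _ _]/f -(deriveE _ df).
  have -> : chart x \o c = fun t : R => f (p0 + t *: xi').
    by apply/funext => t; rewrite /= /f /c /l addrC.
  have d0 : derivable f (p0 + (0 : R) *: xi') xi'.
    by rewrite scale0r addr0; exact: diff_derivable.
  have := is_derive_line d0; rewrite scale0r addr0 => d1.
  exact: (@derive_val _ _ _ _ _ _ _ d1).
Unshelve. all: by end_near. Qed.

(** The lift [h] of the curve is only known to be continuous at 0, so it cannot be differentiated.
    Instead, with [B] the matrix of the orbit map, [L] a right inverse and [T = 1 - L B], the first
    order expansion shows that [g t *m T] is [o(g t)]. Dividing by [t] gives [v T = 0], that is,
    [v = (v L) B]. *)
Lemma vertical_generator x (v : tangent x) :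
  vertical Phi x v -> exists xi, v = infinitesimal_generator Phi xi x.
Proof.
move=> [c [c0 cc sc cv] rc].
have [h [hP h1]] := orbit_curve_lift c0 cc rc.
set e := (1%g : G) in h1 *; set p0 := chart e e; set q := chart x x.
pose f u := chart x (Phi (chart_inv e u) x).
have sf : smooth_near f p0.
  have [_ /(_ e x)] := smooth_act; rewrite act1 => /smooth_near_slice1.
  by rewrite /= chart_invK0.
have df : differentiable f p0 by exact: smooth_near_differentiable.
have fp0 : f p0 = q by rewrite /f chart_invK0 act1.
pose B := lin1_mx ('d f p0).
have BE u : 'd f p0 u = u *m B by rewrite mul_rV_lin1.
have genE (xi : tangent e) : infinitesimal_generator Phi xi x = (xi : 'rV_k) *m B.
  by rewrite generatorE /mder -[chart_map _ _ _]/f BE.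
have Bfree : row_free B.
  rewrite -kermx_eq0; apply/rowV0P => u /sub_kermxP uB.
  by apply: (generator_inj actionPhi freePhi (x := x)); rewrite genE.
pose L := pinvmx B; pose T := 1%:M - L *m B.
have BL : B *m L = 1%:M by exact: mulmxVp.
have BT : B *m T = 0 by rewrite mulmxBr mulmx1 mulmxA BL mul1mx subrr.
have [C1 C10 C1P] := mulmx_norm_bound L.
have [C2 C20 C2P] := mulmx_norm_bound T.
pose g t := chart x (c t) - q.
have gT eta : 0 < eta -> \forall t \near (0 : R), `|g t *m T| <= eta * `|g t|.
  (* The first bound absorbs the error term in [w = g L - E L], so that the norm of [w] is at most
     [2 * C1] times that of [g t]; the second turns this into the required bound on [E T]. *)
  move=> eta0; pose eta' := Num.min (2 * C1)^-1 (eta / (2 * C1 * C2)).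
  have eta'0 : 0 < eta' by rewrite lt_min invr_gt0 divr_gt0 ?mulr_gt0.
  have u1 : chart e (h t) @[t --> (0 : R)] --> p0.
    exact: (cvg_comp _ _ h1 (chart_cvg (mem_chart_dom e))).
  have dE := differentiable_near df eta'0.
  have hdom : \forall t \near (0 : R), chart_dom e (h t).
    exact: h1 _ (nbhs_chart_dom (mem_chart_dom e)).
  have hdE : \forall t \near (0 : R), `|f (chart e (h t)) - f p0 -
      'd f p0 (chart e (h t) - p0)| <= eta' * `|chart e (h t) - p0|.
    exact: u1 _ dE.
  apply: filterS3 hP hdom hdE => t ht dt.
  rewrite {1}/f chart_invK// ht fp0 BE -/(g t).
  set w := chart e (h t) - p0; set E := g t - w *m B => Ew.
  have wE : w = g t *m L - E *m L.
    by rewrite -mulmxBl /E subKr -mulmxA BL mulmx1.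
  have nw : `|w| <= 2 * C1 * `|g t|.
    have : `|w| <= C1 * `|g t| + C1 * `|E|.
      by rewrite {1}wE (le_trans (ler_normB _ _))// lerD.
    have : C1 * `|E| <= `|w| / 2.
      rewrite (le_trans (ler_wpM2l (ltW C10) Ew))// mulrA mulrC ler_wpM2l//.
      rewrite mulrC -ler_pdivlMr// -invfM ge_min lexx//.
    lra.
  have -> : g t *m T = E *m T.
    by rewrite /E [RHS](mulmxBl (g t)) -(mulmxA w) BT mulmx0 subr0.
  rewrite (le_trans (C2P _))// (le_trans (ler_wpM2l (ltW C20) Ew))//.
  rewrite (le_trans (ler_wpM2l (ltW C20) (ler_wpM2l (ltW eta'0) nw)))//.
  rewrite !mulrA ler_wpM2r//.
  have -> : C2 * eta' * 2 * C1 = eta' * (2 * C1 * C2) by ring.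
  by rewrite -ler_pdivlMr ?mulr_gt0// ge_min lexx orbT.
have gv : t^-1 *: g t @[t --> (0 : R)^'] --> (v : 'rV[R]_n).
  have dc : derivable (chart x \o c : R^o -> _) (0 : R^o) (1 : R^o).
    exact: diff_derivable (smooth_near_differentiable sc).
  rewrite -cv derive1E; have := dc; rewrite /derivable /derive.
  suff -> : (fun t : R => t^-1 *: g t) = (fun t => t^-1 *: (((chart x \o c) \o shift (0 : R))
      (t *: (1 : R^o)) - (chart x \o c) 0)) by [].
  by apply/funext => t; rewrite /g /= addr0 [t *: 1]mulr1 c0.
have vT : (v : 'rV_n) *m T = 0.
  apply: contrapT => /eqP vT0.
  have d0 : 0 < `|(v : 'rV_n) *m T| by rewrite normr_gt0.
  (* The estimates below add up to [d <= eta * D], where [eta <= 1] is used to bound the quadratic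
     term; the choice of [eta] makes this at most [d / 2]. *)
  set d := `|_| in d0; pose D := C2 + `|v : 'rV[R]_n| + 1.
  have D0 : 0 < D by rewrite addr_gt0// ltr_pwDl.
  pose eta := Num.min 1 (d / (2 * D)).
  have eta0 : 0 < eta by rewrite lt_min ltr01 divr_gt0// mulr_gt0.
  have eta1 : eta <= 1 by rewrite ge_min lexx.
  have etaD : eta * D <= d / 2.
    rewrite -ler_pdivlMr// -mulrA -invfM ge_min lexx orbT//.
  have n1 : \forall t \near (0 : R)^', `|(v : 'rV_n) - t^-1 *: g t| <= eta.
    by move/cvgrPdist_le : gv; exact.
  have n2 : \forall t \near (0 : R)^', `|g t *m T| <= eta * `|g t|.
    by apply: nbhs_dnbhs; exact: gT.
  have [t [t1 t2]] := filter_ex (filterI n1 n2).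
  set y := t^-1 *: g t in t1.
  have yT : `|y *m T| <= eta * `|y|.
    by rewrite /y -scalemxAl !normrZ mulrCA ler_wpM2l.
  have ny : `|y| <= `|v : 'rV[R]_n| + eta.
    have := ler_normB (v : 'rV[R]_n) (v - y).
    by rewrite subKr => /le_trans; apply; rewrite lerD2l.
  have : d <= C2 * eta + eta * (`|v : 'rV[R]_n| + eta).
    rewrite /d -[X in X *m T](subrK y) mulmxDl (le_trans (ler_normD _ _))//.
    apply: lerD; first by rewrite (le_trans (C2P _))// ler_wpM2l// ltW.
    by rewrite (le_trans yT)// ler_wpM2l// ltW.
  have : eta * eta <= eta * 1 by rewrite ler_wpM2l// ltW.
  move: etaD; rewrite /D !mulrDr mulr1 => a1 a2 a3.
  suff : d <= 0 by rewrite leNgt d0.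
  lra.
exists ((v : 'rV_n) *m L).
rewrite genE -mulmxA; apply/eqP; rewrite -subr_eq0.
by have := vT; rewrite mulmxBr mulmx1 => ->.
Qed.

End VerticalSpace.

(** * Rank arguments and completion of a basis *)

Section MatrixFacts.
Context {F : fieldType}.

Lemma row_full_ker m n (B : 'M[F]_(m, n)) :
  (forall c : 'cV_n, B *m c = 0 -> c = 0) -> row_full B.
Proof.
move=> kerB; rewrite /row_full -mxrank_tr -/(row_free B^T) -kermx_eq0.
apply/rowV0P => u /sub_kermxP uB; apply: trmx_inj; rewrite trmx0; apply: kerB.
by rewrite -[B]trmxK -trmx_mul uB trmx0.
Qed.

Lemma row_base_factor m n (W : 'M[F]_(m, n)) r : \rank W = r ->
  exists K : 'M[F]_(r, m), (K *m W == W)%MS.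
Proof.
move=> <-; have /submxP[K KE] : (row_base W <= W)%MS by rewrite eq_row_base.
by exists K; rewrite -KE; apply/eqmxP; exact: eq_row_base.
Qed.

(** A complement of the row space of [A] can be taken inside that of [X]. Counting ranks, it has
    dimension [r], and a basis of it consists of combinations of rows of [X], whose coefficients
    form [K]. *)
Lemma complete_basis k r d (A : 'M[F]_(k, k + r)) (X : 'M[F]_(d, k + r)) :
  row_free A -> row_full (col_mx A X) ->
  exists K : 'M[F]_(r, d), col_mx A (K *m X) \in unitmx.
Proof.
move=> fA fAX; pose W := (X :\: A)%MS.
have AW : (A + W == A + X)%MS.
  apply/andP; split; first by rewrite addsmxS// diffmxSl.
  rewrite addsmx_sub addsmxSl /=.
  have := addsmx_diff_cap_eq X A => /eqmxP/andP[_ le].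
  apply: (submx_trans le); rewrite addsmx_sub addsmxSr /=.
  by rewrite (submx_trans (capmxSr _ _)) ?addsmxSl.
have rW : \rank W = r.
  have capAW : (A :&: W)%MS = 0.
    by apply/eqP; rewrite -submx0 capmxC capmx_diff.
  have := mxrank_sum_cap A W; rewrite capAW mxrank0 addn0.
  have /eqP -> : \rank (A + W)%MS == (k + r)%N.
    move/eqmxP: AW => AW; rewrite AW (addsmxE A X); exact: fAX.
  by move/eqP: fA => ->; move/addnI.
have [K0 /eqmxP K0E] := row_base_factor rW.
have /submxP[K1 K1E] : (W <= X)%MS by exact: diffmxSl.
exists (K0 *m K1); rewrite -row_full_unit -mulmxA -K1E.
rewrite /row_full -addsmxE (adds_eqmx (eqmx_refl A) K0E).
by move/eqmxP: AW => ->; rewrite addsmxE.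
Qed.

End MatrixFacts.

(** * Pointwise linear algebra of the sharp map *)

Section HorizontalAlgebra.
Context {R : realFieldType} {k d n : nat}.
Variables (A : 'M[R]_(k, n)) (X : 'M[R]_(d, n)) (Q : 'M[R]_d).
Hypothesis Qsym : Q^T = Q.
Hypothesis Qpos : forall u : 'rV_d, u != 0 -> 0 < (u *m Q *m u^T) 0 0.

(** The sharp map of the cometric: a covector, written as a column [c], goes to the row
    [c^T *m sharp_mx], the sum of [g^ij c(X_i) X_j]. *)
Definition sharp_mx : 'M[R]_n := X^T *m invmx Q *m X.

Local Notation S := sharp_mx.

Lemma posdef_unit : Q \in unitmx.
Proof.
rewrite -row_free_unit -kermx_eq0; apply/rowV0P => u /sub_kermxP uQ.
apply: contrapT => /eqP/Qpos; by rewrite uQ mul0mx mxE ltxx.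
Qed.

Lemma trmx_invmx_sym : (invmx Q)^T = invmx Q.
Proof. by rewrite trmx_inv Qsym. Qed.

Lemma sharp_mx_sym : S^T = S.
Proof. by rewrite /S !trmx_mul trmxK trmx_inv Qsym mulmxA. Qed.

(** The left side is the value of the positive definite form [Q] at [u = (X c)^T Q^-1], so [u]
    vanishes and with it [X c]. *)
Lemma sharp_quad0 (c : 'cV_n) : c^T *m S *m c = 0 -> X *m c = 0.
Proof.
move=> cSc; pose u := (X *m c)^T *m invmx Q.
have : (u *m Q *m u^T) = 0.
  have uT : u^T = invmx Q *m (X *m c).
    by rewrite /u trmx_mul trmxK trmx_invmx_sym.
  rewrite uT /u mulmxKV ?posdef_unit// -cSc.
  by rewrite /S trmx_mul !mulmxA.
move=> uQu; have [u0|/Qpos] := eqVneq u 0; last by rewrite uQu mxE ltxx.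
apply: trmx_inj; rewrite trmx0 -[LHS](mulmxKV posdef_unit) -/u u0 mul0mx.
by [].
Qed.

Lemma sharp0 (c : 'cV_n) : X *m c = 0 -> c^T *m S = 0.
Proof. by move=> Xc; rewrite /S !mulmxA -trmx_mul Xc trmx0 !mul0mx. Qed.

(** Pairing the equation with [c] gives [c^T S c = xi (A c) = 0], and [sharp_quad0] applies. *)
Lemma sharp_disjoint (c : 'cV_n) (xi : 'rV_k) :
  A *m c = 0 -> c^T *m S = xi *m A -> c^T *m S = 0.
Proof.
move=> Ac cS; apply: sharp0; apply: sharp_quad0.
by rewrite cS -mulmxA Ac mulmx0.
Qed.

Hypothesis inj : forall c : 'cV_n, A *m c = 0 -> c^T *m S = 0 -> c = 0.

Lemma ker_generators (c : 'cV_n) : A *m c = 0 -> X *m c = 0 -> c = 0.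
Proof. by move=> Ac Xc; apply: inj => //; exact: sharp0. Qed.

Lemma row_full_generators : row_full (col_mx A X).
Proof.
apply: row_full_ker => c; rewrite mul_col_mx -[0]col_mx0 => /eq_col_mx[Ac Xc].
exact: ker_generators.
Qed.

(** By duality it suffices that a covector [c] killing both summands is zero. Killing the
    generators, it lies in the annihilator itself; killing its image under sharp then gives
    [c^T S c = 0], so [c] also kills the [X] rows and vanishes by [ker_generators]. *)
Lemma horizontal_decomposition (v : 'rV_n) :
  exists c (xi : 'rV_k), A *m c = 0 /\ v = c^T *m S + xi *m A.
Proof.
(* The rows of [N] span the transposed covectors that vanish on the generators. *)
pose N := kermx A^T.
have AN : A *m N^T = 0 by apply: trmx_inj; rewrite trmx_mul trmxK mulmx_ker trmx0.
have : row_full (col_mx (N *m S) A).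
  apply: row_full_ker => c; rewrite mul_col_mx -[0]col_mx0 => /eq_col_mx[NSc Ac].
  apply: ker_generators => //; apply: sharp_quad0.
  have /submxP[w wN] : (c^T <= N)%MS.
    by apply/sub_kermxP; rewrite -trmx_mul Ac trmx0.
  by rewrite wN -(mulmxA w) -(mulmxA w) NSc mulmx0.
move=> /(submx_full v)/submxP[w].
rewrite -[w]hsubmxK mul_row_col => ->.
exists (N^T *m (lsubmx w)^T), (rsubmx w); split.
  by rewrite mulmxA AN mul0mx.
by rewrite trmx_mul !trmxK !mulmxA.
Qed.

End HorizontalAlgebra.

(** * A horizontal frame built from a dual coframe *)

Section HorizontalFrame.
Context {R : realFieldType} {k r d : nat}.
Variables (A : 'M[R]_(k, k + r)) (X : 'M[R]_(d, k + r)) (Q : 'M[R]_d).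
Variable (K : 'M[R]_(r, d)).
Hypothesis Eunit : col_mx A (K *m X) \in unitmx.

Let E := col_mx A (K *m X).

(** The columns of the inverse of [E] are the coframe dual to its rows; the last [r] of them vanish
    on the rows of [A]. *)
Definition dual_frame : 'M[R]_(k + r, r) := rsubmx (invmx E).

Definition horizontal_frame : 'M[R]_(r, k + r) := dual_frame^T *m sharp_mx X Q.

Lemma dual_frameP : A *m dual_frame = 0 /\ K *m X *m dual_frame = 1%:M.
Proof.
have : E *m invmx E = 1%:M by rewrite mulmxV.
rewrite -[invmx E]hsubmxK mul_mx_row /E !mul_col_mx -/dual_frame.
by rewrite -block_mxEh (scalar_mx_block k r) => /eq_block_mx[].
Qed.

(** In the dual coframe, the coefficients of [c] are its values on the rows of [E], and those on [A]
    are zero. *)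
Lemma dual_frame_expansion (c : 'cV_(k + r)) :
  A *m c = 0 -> c = dual_frame *m (K *m X *m c).
Proof.
move=> Ac; rewrite -[LHS](mulKmx Eunit) -/E {2}/E mul_col_mx Ac.
by rewrite -{1}[invmx E]hsubmxK mul_row_col mulmx0 add0r.
Qed.

Lemma horizontal_frame_span (v : 'rV_(k + r)) :
  (exists2 c : 'cV_(k + r), A *m c = 0 & v = c^T *m sharp_mx X Q) <->
  exists u : 'rV_r, v = u *m horizontal_frame.
Proof.
split=> [[c Ac ->]|[u ->]].
  exists (K *m X *m c)^T; rewrite {1}(dual_frame_expansion Ac).
  by rewrite /horizontal_frame [RHS]mulmxA -trmx_mul.
exists (dual_frame *m u^T).
  by rewrite mulmxA (dual_frameP.1) mul0mx.
by rewrite trmx_mul trmxK mulmxA.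
Qed.

Lemma horizontal_frame_free :
  (forall c : 'cV_(k + r), A *m c = 0 -> c^T *m sharp_mx X Q = 0 -> c = 0) ->
  row_free horizontal_frame.
Proof.
move=> inj; rewrite -kermx_eq0; apply/rowV0P => u /sub_kermxP uY.
have /inj : A *m (dual_frame *m u^T) = 0 by rewrite mulmxA (dual_frameP.1) mul0mx.
rewrite trmx_mul trmxK -mulmxA -/horizontal_frame uY => /(_ erefl) Cu.
apply: trmx_inj; rewrite trmx0; have := congr1 (mulmx (K *m X)) Cu.
by rewrite mulmxA (dual_frameP.2) mul1mx mulmx0.
Qed.

End HorizontalFrame.

(** * Spans and freeness of tuples in matrix form *)

Section RowSpans.
Context {R : realType} {n : nat}.

Lemma mem_span_rows r (F : 'I_r -> 'rV[R]_n) (v : 'rV[R]_n) :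
  v \in <<[tuple F i | i < r]>>%VS <-> exists u : 'rV_r, v = u *m \matrix_i F i.
Proof.
have sumE (u : 'rV_r) : u *m \matrix_i F i = \sum_i u 0 i *: F i.
  by rewrite mulmx_sum_row; apply: eq_bigr => i _; rewrite rowK.
split=> [/coord_span vE|[u ->]].
  exists (\row_i coord [tuple F i | i < r] i v); rewrite sumE {1}vE.
  by apply: eq_bigr => i _; rewrite mxE -tnth_nth tnth_mktuple.
rewrite sumE; apply: memv_suml => i _; apply: memvZ; apply: memv_span.
by apply/tnthP; exists i; rewrite tnth_mktuple.
Qed.

Lemma free_rows r (F : 'I_r -> 'rV[R]_n) :
  free [tuple F i | i < r] = row_free (\matrix_i F i).
Proof.
have sumE (u : 'rV_r) : u *m \matrix_i F i = \sum_i u 0 i *: [tuple F i | i < r]`_i.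
  rewrite mulmx_sum_row; apply: eq_bigr => i _.
  by rewrite rowK -tnth_nth tnth_mktuple.
apply/idP/idP => [/freeP fF|fF].
  rewrite -kermx_eq0; apply/rowV0P => u /sub_kermxP; rewrite sumE => /fF u0.
  by apply/rowP => i; rewrite mxE; exact: u0.
apply/freeP => c c0 i.
suff : \row_i c i = 0 by move/rowP/(_ i); rewrite !mxE.
apply: (row_free_inj fF); rewrite mul0mx sumE -[RHS]c0.
by apply: eq_bigr => j _; rewrite mxE.
Qed.

End RowSpans.

Lemma is_derive_quadratic (R : realType) (a b c : R) :
  is_derive (0 : R^o) 1 (fun e : R^o => a + e * b + e * e * c : R^o) (b : R^o).
Proof.
have d1 := is_deriveD (is_derive_cst a (0 : R) (1 : R)) (is_derive_mulr b 0).
have id0 := is_derive_id (0 : R) (1 : R).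
have d2 := is_deriveM (is_deriveM id0 id0) (is_derive_cst c (0 : R) (1 : R)).
have d := is_deriveD d1 d2.
apply: (is_derive_eq d).
rewrite !scaler0 add0r add0r [X in _ *: (X + _)](_ : _ = 0); last exact: mul0r.
by rewrite add0r [X in _ *: X](_ : _ = 0) ?scaler0 ?addr0//; exact: mul0r.
Qed.

(** * Covectors as columns *)

Section Covectors.
Context {R : realType} {n : nat} {M : manifoldType R n}.

Definition cov_mx (x : M) (a : cotangent x) : 'cV[R]_n :=
  \col_j (a (delta_mx 0 j : 'rV[R]_n) : R).

Lemma cov_mxE (x : M) (a : cotangent x) (v : tangent x) :
  a v = ((v : 'rV[R]_n) *m cov_mx a) 0 0.
Proof.
rewrite mxE {1}[v : 'rV_n]row_sum_delta linear_sum /=.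
by apply: eq_bigr => j _; rewrite linearZ /= mxE.
Qed.

Lemma cov_mx_surj (x : M) (c : 'cV[R]_n) : exists a : cotangent x, cov_mx a = c.
Proof.
have lin : linear (fun v : tangent x => ((v : 'rV[R]_n) *m c) 0 0 : R^o).
  by move=> t u v; rewrite mulmxDl -scalemxAl !mxE.
pose lM := GRing.isLinear.Build _ _ _ _ _ lin.
pose L : {linear tangent x -> R^o} :=
  HB.pack (fun v : tangent x => ((v : 'rV[R]_n) *m c) 0 0 : R^o) lM.
exists (linfun L); apply/colP => j.
by rewrite mxE lfunE /= -rowE mxE.
Qed.

Lemma cov_mx_lincomb (x : M) (a b : cotangent x) (e : R) :
  cov_mx (a + e *: b) = cov_mx a + e *: cov_mx b.
Proof. by apply/colP => j; rewrite !mxE add_lfunE scale_lfunE. Qed.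

End Covectors.

(** * The horizontal space in matrix form and as an orthogonal complement *)

Section HorizontalSpace.
Context {R : realType} {n k d : nat} {M : manifoldType R n} {G : lieGroupType R k}.
Variable Phi : G -> M -> M.
Variable X : 'I_d -> forall x : M, tangent x.
Variable g : forall x : M, tangent x -> tangent x -> R.
Hypothesis freeX : forall x, free [tuple X i x | i < d].
Hypothesis metric_g : sub_riemannian_metric (distribution_span X) g.

(** Its rows are the values at [x] of the generators of the standard basis of the Lie algebra. *)
Definition generator_mx (x : M) : 'M[R]_(k, n) :=
  lin1_mx ('d (chart_map (1%g : G) x (Phi^~ x)) (chart (1%g : G) 1%g)).

Definition field_mx (x : M) : 'M[R]_(d, n) := \matrix_i (X i x : 'rV[R]_n).

Local Notation A := generator_mx.
Local Notation XM := field_mx.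
Local Notation Q := (gram X g).
Local Notation S := (fun x => sharp_mx (XM x) (Q x)).

Lemma generator_mxE (x : M) (xi : tangent (1%g : G)) :
  infinitesimal_generator Phi xi x = (xi : 'rV[R]_k) *m A x.
Proof. by rewrite generatorE /mder mul_rV_lin1. Qed.

Lemma momentum_zeroP (x : M) (a : cotangent x) :
  momentum_zero Phi x a <-> A x *m cov_mx a = 0.
Proof.
(* [linfun] evaluates to the given function only when that function carries a linear structure, so
   linearity is established first. *)
have lin : linear (fun xi : tangent (1%g : G) =>
    a (infinitesimal_generator Phi xi x) : R^o).
  move=> t u v; rewrite !generator_mxE !cov_mxE !mulmxDl -!scalemxAl.
  by rewrite mxE [X in X + _]mxE.
pose lM := GRing.isLinear.Build _ _ _ _ _ lin.
pose L : {linear tangent (1%g : G) -> R^o} := HB.pack (fun xi : tangent (1%g : G) =>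
    a (infinitesimal_generator Phi xi x) : R^o) lM.
have mE xi : momentum_map Phi a xi = ((xi : 'rV_k) *m (A x *m cov_mx a)) 0 0.
  rewrite -[momentum_map Phi a]/(linfun L) lfunE /= cov_mxE generator_mxE.
  by rewrite mulmxA.
split=> [m0|Aa].
  apply/colP => i; have := mE (delta_mx 0 i).
  by rewrite m0 lfunE /= -rowE !mxE => <-.
by apply/lfunP => xi; rewrite mE Aa mulmx0 mxE lfunE.
Qed.

Lemma mem_distribution_span (x : M) (v : tangent x) :
  v \in distribution_span X x <-> exists u : 'rV[R]_d, v = u *m XM x.
Proof. exact: (mem_span_rows (fun i => X i x : 'rV[R]_n)). Qed.

Lemma mem_field_comb (x : M) (u : 'rV[R]_d) :
  (u *m XM x : tangent x) \in distribution_span X x.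
Proof. by apply/mem_distribution_span; exists u. Qed.

Lemma field_mem (x : M) i : X i x \in distribution_span X x.
Proof.
by apply: memv_span; apply/tnthP; exists i; rewrite tnth_mktuple.
Qed.

Lemma field_mx_free (x : M) : row_free (XM x).
Proof. by rewrite -(free_rows (fun i => X i x : 'rV[R]_n)); exact: freeX. Qed.

Lemma gram_sym (x : M) : (Q x)^T = Q x.
Proof.
apply/matrixP => i j; rewrite !mxE; case: metric_g => _ sym _ _.
by apply: sym; exact: field_mem.
Qed.

Lemma metric_field_l (x : M) (u : 'rV[R]_d) (w : tangent x) :
  w \in distribution_span X x ->
  g (u *m XM x : tangent x) w = \sum_i u 0 i * g (X i x) w.
Proof.
move=> Dw; case: metric_g => lin _ _ _.
have g0 : g (0 : tangent x) w = 0.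
  have := lin x 1 0 0 w (mem0v _) (mem0v _) Dw.
  rewrite scaler0 addr0 mul1r => /eqP.
  by rewrite -subr_eq0 opprD addNKr oppr_eq0 => /eqP.
rewrite mulmx_sum_row.
(* The metric is linear only on the distribution, so the induction also records that partial sums
   stay in it. *)
suff H (s : seq 'I_d) : (\sum_(i <- s) u 0 i *: row i (XM x) : tangent x)
      \in distribution_span X x /\
    g (\sum_(i <- s) u 0 i *: row i (XM x) : tangent x) w =
    \sum_(i <- s) u 0 i * g (X i x) w by case: (H (index_enum _)).
elim: s => [|i s [IH1 IH2]]; first by rewrite !big_nil; split=> //; exact: mem0v.
rewrite !big_cons rowK; split.
  by apply: memvD => //; apply: memvZ; exact: field_mem.
by rewrite lin ?IH2//; exact: field_mem.
Qed.

Lemma metric_mx (x : M) (u w : 'rV[R]_d) :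
  g (u *m XM x : tangent x) (w *m XM x : tangent x) = (u *m Q x *m w^T) 0 0.
Proof.
have [_ sym _ _] := metric_g.
rewrite metric_field_l; last exact: mem_field_comb.
rewrite -mulmxA mxE; apply: eq_bigr => i _; congr (_ * _).
rewrite sym ?field_mem ?mem_field_comb// metric_field_l ?field_mem//.
rewrite mxE; apply: eq_bigr => j _; rewrite !mxE mulrC; congr (_ * _).
by apply: sym; exact: field_mem.
Qed.

Lemma gram_pos (x : M) (u : 'rV[R]_d) : u != 0 -> 0 < (u *m Q x *m u^T) 0 0.
Proof.
move=> u0; rewrite -metric_mx; case: metric_g => _ _ pos _.
apply: pos; first exact: mem_field_comb.
apply: contra_neq u0 => uX; apply: (row_free_inj (field_mx_free x)).
by rewrite mul0mx.
Qed.

Lemma H_df_mx (x : M) (a : cotangent x) :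
  H_df X g a = 2^-1 * ((cov_mx a)^T *m S x *m cov_mx a) 0 0.
Proof.
rewrite /H_df; congr (_ * _).
pose y : 'cV[R]_d := XM x *m cov_mx a.
have yE i : a (X i x) = y i 0.
  rewrite cov_mxE /y [LHS]mxE [RHS]mxE; apply: eq_bigr => j _.
  by rewrite [XM x i j]mxE.
have -> : (cov_mx a)^T *m S x *m cov_mx a = y^T *m invmx (Q x) *m y.
  by rewrite /y /sharp_mx trmx_mul !mulmxA.
rewrite mxE exchange_big; apply: eq_bigr => j _ /=.
rewrite mxE mulr_suml; apply: eq_bigr => i _.
by rewrite !yE [y^T 0 i]mxE [_ * y i 0]mulrC.
Qed.

(** [H_df] is half the quadratic form of the symmetric matrix [S x], so its polarization gives the
    linear coefficient in [e]. *)
Lemma fiber_derivative_sharp (x : M) (a : cotangent x) :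
  fiber_derivative (H_df X g) x a = (cov_mx a)^T *m S x.
Proof.
have dP (b : cotangent x) : is_derive (0 : R^o) 1
    (fun e : R^o => H_df X g (a + e *: b) : R^o)
    (b ((cov_mx a)^T *m S x : tangent x)).
  set c := cov_mx a; set c' := cov_mx b.
  pose q (u v : 'cV[R]_n) : R := (u^T *m S x *m v) 0 0.
  have symq u v : q u v = q v u.
    rewrite /q; have -> : (u^T *m S x *m v) 0 0 = (u^T *m S x *m v)^T 0 0.
      by rewrite [RHS]mxE.
    by rewrite trmx_mul (trmx_mul u^T) trmxK (sharp_mx_sym _ (gram_sym x)) mulmxA.
  have -> : b ((cov_mx a)^T *m S x : tangent x) = q c c' by rewrite cov_mxE.
  have -> : (fun e : R^o => H_df X g (a + e *: b) : R^o) =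
      (fun e : R^o => 2^-1 * q c c + e * q c c' + e * e * (2^-1 * q c' c') : R^o).
    apply/funext => e; rewrite H_df_mx cov_mx_lincomb -/c -/c'.
    have -> : ((c + e *: c')^T *m S x *m (c + e *: c')) 0 0 =
        q c c + e * q c c' + (e * q c' c + e * (e * q c' c')).
      have tE : (c + e *: c')^T = c^T + e *: c'^T.
        by apply/matrixP => i j; rewrite !mxE.
      rewrite /q tE !mulmxDl !mulmxDr -!scalemxAr -!scalemxAl.
      by rewrite !mxE.
    by rewrite (symq c' c); field.
  exact: is_derive_quadratic.
(* The value selected by [xget] is determined because covectors separate vectors: testing on
   coordinate covectors is enough. *)
apply: xget_unique => [b|v vP]; first exact: dP.
apply/eqP; rewrite -subr_eq0; apply/eqP/rowP => j.
have [b bE] := cov_mx_surj x (delta_mx j 0 : 'cV[R]_n).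
have e1 := @derive_val _ _ _ _ _ _ _ (vP b).
have e2 := @derive_val _ _ _ _ _ _ _ (dP b).
have : b v = b ((cov_mx a)^T *m S x : tangent x) by rewrite -e1 -e2.
rewrite !cov_mxE bE => /eqP; rewrite -subr_eq0 -!colE !mxE => /eqP.
by [].
Qed.

Lemma horizontalP (x : M) (v : tangent x) :
  (fiber_derivative (H_df X g) x @` momentum_zero Phi x) v <->
  exists2 c : 'cV[R]_n, A x *m c = 0 & v = c^T *m S x.
Proof.
split=> [[a /momentum_zeroP Aa <-]|[c Ac ->]].
  by exists (cov_mx a) => //; exact: fiber_derivative_sharp.
have [a aE] := cov_mx_surj x c; exists a; last by rewrite fiber_derivative_sharp aE.
by apply/momentum_zeroP; rewrite aE.
Qed.

Hypothesis nondegenerate : forall x : M,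
  set_inj (momentum_zero Phi x) (fiber_derivative (H_df X g) x).

(** Non-degeneracy is applied to [c] and the zero covector, which have the same image. *)
Lemma sharp_inj (x : M) (c : 'cV[R]_n) :
  A x *m c = 0 -> c^T *m S x = 0 -> c = 0.
Proof.
move=> Ac cS; have [a aE] := cov_mx_surj x c; have [b bE] := cov_mx_surj x 0.
rewrite -aE -bE; congr cov_mx; apply: (@nondegenerate x).
- by rewrite inE; apply/momentum_zeroP; rewrite aE.
- by rewrite inE; apply/momentum_zeroP; rewrite bE mulmx0.
- by rewrite !fiber_derivative_sharp aE bE cS trmx0 mul0mx.
Qed.

(* The horizontal space is the g-orthogonal complement, inside the
   distribution, of the part of the distribution tangent to the orbits; this
   description only involves G-invariant data. *)
Lemma horizontal_orthogonal (x : M) (v : tangent x) :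
  (fiber_derivative (H_df X g) x @` momentum_zero Phi x) v <->
  v \in distribution_span X x /\
  forall xi : tangent (1%g : G),
    infinitesimal_generator Phi xi x \in distribution_span X x ->
    g v (infinitesimal_generator Phi xi x) = 0.
Proof.
(* For any vector in the distribution, its product under [g] with the sharp of [c] is its pairing
   with [c]; on a generator this pairing is zero. *)
have orth (c : 'cV[R]_n) (xi : tangent (1%g : G)) : A x *m c = 0 ->
    infinitesimal_generator Phi xi x \in distribution_span X x ->
    g (c^T *m S x : tangent x) (infinitesimal_generator Phi xi x) = 0.
  move=> Ac /mem_distribution_span[b bE]; rewrite bE.
  rewrite /sharp_mx mulmxA metric_mx mulmxA.
  rewrite mulmxKV ?posdef_unit//; last exact: gram_pos.
  rewrite -trmx_mul -trmx_mul mulmxA -bE generator_mxE.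
  by rewrite -mulmxA Ac mulmx0 trmx0 mxE.
rewrite horizontalP; split=> [[c Ac ->]|[Dv orthv]].
  split=> [|xi Dxi]; last exact: orth.
  apply/mem_distribution_span; exists (c^T *m ((XM x)^T *m invmx (Q x))).
  by rewrite !mulmxA.
(* Conversely, the vertical component of [v] is a difference of vectors in the distribution that are
   both orthogonal to it; being orthogonal to itself, it vanishes. *)
have [c [xi [Ac vE]]] := horizontal_decomposition (gram_sym x) (gram_pos x)
  (@sharp_inj x) v.
exists c => //.
have Dc : (c^T *m S x : tangent x) \in distribution_span X x.
  apply/mem_distribution_span; exists (c^T *m ((XM x)^T *m invmx (Q x))).
  by rewrite !mulmxA.
have aE : infinitesimal_generator Phi (xi : tangent (1%g : G)) x = (v : 'rV_n) - c^T *m S x.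
  by rewrite generator_mxE vE addrC addKr.
have Da : infinitesimal_generator Phi (xi : tangent (1%g : G)) x \in distribution_span X x.
  by rewrite aE; apply: memvB.
have [lin sym pos _] := metric_g.
have := lin x (-1) (c^T *m S x : tangent x) v
  (infinitesimal_generator Phi (xi : tangent (1%g : G)) x) Dc Dv Da.
rewrite orth// orthv// mulr0 addr0.
rewrite scaleN1r addrC -[v - _]/((v : 'rV_n) - c^T *m S x) -aE => gaa.
apply/eqP; rewrite -subr_eq0 -[v - _]/((v : 'rV_n) - c^T *m S x) -aE.
apply: contrapT => /negP a0; have := pos x _ Da a0.
by rewrite gaa ltxx.
Qed.

End HorizontalSpace.

(** * Invariance of the horizontal spaces under the action *)

Section Invariance.
Context {R : realType} {n k d : nat} {M : manifoldType R n} {G : lieGroupType R k}.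
Variable Phi : G -> M -> M.
Variable X : 'I_d -> forall x : M, tangent x.
Variable g : forall x : M, tangent x -> tangent x -> R.
Hypothesis actionPhi : smooth_left_action Phi.
Hypothesis freeX : forall x, free [tuple X i x | i < d].
Hypothesis metric_g : sub_riemannian_metric (distribution_span X) g.
Hypothesis invariant_g : invariant_metric Phi (distribution_span X) g.
Hypothesis invariant_D : forall h x,
  (tmap (Phi h) x @: distribution_span X x)%VS = distribution_span X (Phi h x).
Hypothesis nondegenerate : forall x : M,
  set_inj (momentum_zero Phi x) (fiber_derivative (H_df X g) x).

Local Notation H := (fun x => fiber_derivative (H_df X g) x @` momentum_zero Phi x).

Lemma tmap_distribution h x y (v : tangent x) : Phi h x = y ->
  v \in distribution_span X x -> tmap_to (Phi h) x y v \in distribution_span X y.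
Proof.
move=> hxy; subst y => Dv; rewrite -invariant_D.
exact: (memv_img (tmap (Phi h) x) Dv).
Qed.

Lemma tmap_metric h x y (v w : tangent x) : Phi h x = y ->
  v \in distribution_span X x -> w \in distribution_span X x ->
  g (tmap_to (Phi h) x y v) (tmap_to (Phi h) x y w) = g v w.
Proof. by move=> hxy; subst y => Dv Dw; exact: invariant_g. Qed.

Lemma act_inv h x y : Phi h x = y -> Phi h^-1%g y = x.
Proof. by case: actionPhi => a1 aM _ <-; rewrite -aM mulVg a1. Qed.

(** A generator at [y] lying in the distribution is pulled back by [h^-1] to one at [x];
    orthogonality there is carried forward by the invariance of the metric. *)
Lemma tmap_horizontal h x y (v : tangent x) : Phi h x = y ->
  H x v -> H y (tmap_to (Phi h) x y v).
Proof.
move=> hxy.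
move=> /(horizontal_orthogonal freeX metric_g nondegenerate)[Dv orthv].
apply/(horizontal_orthogonal freeX metric_g nondegenerate); split.
  exact: tmap_distribution.
move=> xi Dxi; have hyx := act_inv hxy.
have [xi' xiE] := tmap_generator actionPhi xi hyx.
have Dxi' : infinitesimal_generator Phi xi' x \in distribution_span X x.
  by rewrite -xiE; exact: tmap_distribution.
have wE : tmap_to (Phi h) x y (infinitesimal_generator Phi xi' x) =
    infinitesimal_generator Phi xi y.
  by rewrite -xiE; exact: tmap_act_inv.
by have := tmap_metric hxy Dv Dxi'; rewrite wE orthv.
Qed.

Lemma tmap_horizontal_image h x : tmap (Phi h) x @` H x = H (Phi h x).
Proof.
apply/seteqP; split=> [_ [v Hv <-]|w Hw]; first exact: tmap_horizontal.
have hyx := act_inv (erefl (Phi h x)).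
exists (tmap_to (Phi h^-1%g) (Phi h x) x w); first exact: tmap_horizontal.
exact: tmap_act_inv.
Qed.

End Invariance.

(** * The splitting into horizontal and vertical spaces *)

Section Splitting.
Context {R : realType} {n k d : nat} {M : manifoldType R n} {G : lieGroupType R k}.
Variable Phi : G -> M -> M.
Variable X : 'I_d -> forall x : M, tangent x.
Variable g : forall x : M, tangent x -> tangent x -> R.
Hypothesis actionPhi : smooth_left_action Phi.
Hypothesis freePhi : free_action Phi.
Hypothesis properPhi : proper_action Phi.
Hypothesis freeX : forall x, free [tuple X i x | i < d].
Hypothesis metric_g : sub_riemannian_metric (distribution_span X) g.
Hypothesis nondegenerate : forall x : M,
  set_inj (momentum_zero Phi x) (fiber_derivative (H_df X g) x).

Local Notation H := (fun x => fiber_derivative (H_df X g) x @` momentum_zero Phi x).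

Lemma generator_mx_free x : row_free (generator_mx Phi x).
Proof.
rewrite -kermx_eq0; apply/rowV0P => u /sub_kermxP uA.
by apply: (generator_inj actionPhi freePhi (x := x)); rewrite generator_mxE.
Qed.

Lemma horizontal_vertical_direct_sum x : direct_sum (H x) (vertical Phi x).
Proof.
set A := generator_mx Phi x.
set S := sharp_mx (field_mx X x) (gram X g x).
(* The rows of [N] span the annihilator of the generators, so those of [N *m S] span the horizontal
   space, while those of [A] span the vertical one. *)
pose N := kermx A^T.
pose U := <<[tuple (row i (N *m S) : tangent x) | i < n]>>%VS.
pose W := <<[tuple (row i A : tangent x) | i < k]>>%VS.
have rowsE m (F : 'M[R]_(m, n)) : \matrix_i row i F = F.
  by apply/row_matrixP => i; rewrite rowK.
have UP (v : tangent x) : v \in U <-> H x v.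
  rewrite (mem_span_rows (fun i => row i (N *m S))) rowsE.
  rewrite (horizontalP Phi metric_g); split=> [[u ->]|[c Ac ->]].
    exists (u *m N)^T; last by rewrite trmxK mulmxA.
    by apply: trmx_inj; rewrite trmx_mul trmxK -mulmxA mulmx_ker mulmx0 trmx0.
  have /submxP[w ->] : (c^T <= N)%MS.
    by apply/sub_kermxP; rewrite -trmx_mul Ac trmx0.
  by exists w; rewrite -(mulmxA w).
have WP (v : tangent x) : v \in W <-> vertical Phi x v.
  rewrite (mem_span_rows (fun i => row i A)) rowsE; split=> [[u ->]|].
    by have := generator_tangent_to actionPhi x u; rewrite generator_mxE.
  move=> /(vertical_generator actionPhi freePhi properPhi)[xi ->].
  by exists xi; rewrite generator_mxE.
exists U, W; split.
- by apply/seteqP; split=> v /UP.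
- by apply/seteqP; split=> v /WP.
- apply/vspaceP => v; rewrite memvf; apply/memv_addP.
  have [c [xi [Ac vE]]] := horizontal_decomposition (gram_sym metric_g x)
    (gram_pos freeX metric_g x) (sharp_inj metric_g nondegenerate (x := x)) v.
  exists (c^T *m S); first by apply/UP/(horizontalP Phi metric_g); exists c.
  exists (xi *m A) => //; apply/WP; rewrite -generator_mxE.
  exact: generator_tangent_to.
- apply/eqP; rewrite -subv0; apply/subvP => v; rewrite memv_cap memv0.
  move=> /andP[/UP/(horizontalP Phi metric_g)[c Ac vE]].
  move=> /WP/(vertical_generator actionPhi freePhi properPhi)[xi xiE].
  rewrite vE; apply/eqP; apply: (sharp_disjoint (gram_sym metric_g x)
    (gram_pos freeX metric_g x) Ac (xi := xi)).
  by rewrite -vE xiE generator_mxE.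
Qed.

End Splitting.

(** * Smooth local frames of the horizontal distribution *)

Section SmoothFrame.
Context {R : realType} {k r d : nat} {M : manifoldType R (k + r)}
  {G : lieGroupType R k}.
Variable Phi : G -> M -> M.
Variable X : 'I_d -> forall x : M, tangent x.
Variable g : forall x : M, tangent x -> tangent x -> R.
Hypothesis actionPhi : smooth_left_action Phi.
Hypothesis freePhi : free_action Phi.
Hypothesis smoothX : forall i, smooth_vf (X i).
Hypothesis freeX : forall x, free [tuple X i x | i < d].
Hypothesis metric_g : sub_riemannian_metric (distribution_span X) g.
Hypothesis nondegenerate : forall x : M,
  set_inj (momentum_zero Phi x) (fiber_derivative (H_df X g) x).

Local Notation H := (fun x => fiber_derivative (H_df X g) x @` momentum_zero Phi x).
Local Notation A := (generator_mx Phi).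
Local Notation XM := (field_mx X).
Local Notation Q := (gram X g).

(** The Jacobian from the preferred chart at the moving point to the fixed chart at [x0]. Preferred
    charts may vary arbitrarily with the point, so [J] need not be smooth in [z]; the products
    [Ahat] and [Xhat], which represent vector fields in one chart, are. *)
Let J (x0 : M) (z : 'rV[R]_(k + r)) : 'M[R]_(k + r) :=
  lin1_mx ('d (chart x0 \o chart_inv (chart_inv x0 z))
    (chart (chart_inv x0 z) (chart_inv x0 z))).

Let vf_repE (Z : forall x : M, tangent x) x0 z :
  vf_rep Z x0 z = (Z (chart_inv x0 z) : 'rV_(k + r)) *m J x0 z.
Proof. by rewrite /vf_rep /J mul_rV_lin1. Qed.

Let J1 x0 : J x0 (chart x0 x0) = 1%:M.
Proof.
apply/row_matrixP => i; rewrite rowE row1 mul_rV_lin1 chart_invK0.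
exact: (mder_id (mem_chart_dom x0)).
Qed.

Let Ahat x0 z := A (chart_inv x0 z) *m J x0 z.
Let Xhat x0 z := XM (chart_inv x0 z) *m J x0 z.

Let smooth_Ahat x0 : smooth_mx (Ahat x0) (chart x0 x0).
Proof.
move=> i j.
have s := smooth_vf_generator actionPhi (delta_mx 0 i : 'rV[R]_k) (I : [set: M] x0).
apply: smooth_near_ext (smooth_near_coord j s); near=> z.
rewrite vf_repE generator_mxE -mulmxA -rowE.
by rewrite mxE.
Unshelve. all: by end_near. Qed.

Let smooth_Xhat x0 : smooth_mx (Xhat x0) (chart x0 x0).
Proof.
move=> i j; apply: smooth_near_ext (smooth_near_coord j (smoothX i (I : [set: M] x0))).
near=> z; rewrite vf_repE /Xhat [RHS]mxE [LHS]mxE; apply: eq_bigr => l _.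
by rewrite [XM _ i l]mxE.
Unshelve. all: by end_near. Qed.

Let smooth_gram x0 : smooth_mx (fun z => Q (chart_inv x0 z)) (chart x0 x0).
Proof.
move=> i j; under eq_fun do rewrite mxE.
have [_ _ _ sg] := metric_g.
exact: (sg (X i) (X j) (smoothX i) (smoothX j) (fun x => field_mem _ _ _)
  (fun x => field_mem _ _ _) x0).
Qed.

Section WithCoefficients.
Variable K : 'M[R]_(r, d).

Let E x := col_mx (A x) (K *m XM x).
Let Ehat x0 z := col_mx (Ahat x0 z) (K *m Xhat x0 z).

Let EhatE x0 z : Ehat x0 z = E (chart_inv x0 z) *m J x0 z.
Proof. by rewrite /Ehat /E mul_col_mx mulmxA. Qed.

Let smooth_Ehat x0 : smooth_mx (Ehat x0) (chart x0 x0).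
Proof.
move=> i j; under eq_fun do rewrite mxE.
case: (fintype.split i) => i'; first exact: smooth_Ahat.
exact: (smooth_mxM (smooth_mx_cst K _) (@smooth_Xhat x0)).
Qed.

Let near_unit x0 : E x0 \in unitmx ->
  \forall z \near chart x0 x0, Ehat x0 z \in unitmx.
Proof.
move=> uE; have sdet := smooth_det (@smooth_Ehat x0).
have nz : \forall z \near chart x0 x0, \det (Ehat x0 z) != 0.
  apply: cvgr_neq0 _ (smooth_near_continuous sdet) _.
  by rewrite EhatE J1 mulmx1 chart_invK0 -unitfE -unitmxE.
by apply: filterS nz => z; rewrite unitmxE unitfE.
Qed.

Let unit_Ehat x0 z : Ehat x0 z \in unitmx -> E (chart_inv x0 z) \in unitmx.
Proof. by rewrite EhatE unitmx_mul => /andP[]. Qed.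

Definition horizontal_field (s : 'I_r) (x : M) : tangent x :=
  row s (horizontal_frame (A x) (XM x) (Q x) K).

(** In [Xhat Ehat^-1 = (X J) (E J)^-1] the Jacobian cancels, so the coefficients on the [X i] are
    chart independent. The remaining factor [J] turns the last [X] into [Xhat], and only smooth
    matrices are left. *)
Let horizontal_field_rep s x0 z : Ehat x0 z \in unitmx ->
  vf_rep (horizontal_field s) x0 z =
  row s ((Xhat x0 z *m rsubmx (invmx (Ehat x0 z)))^T *m
    invmx (Q (chart_inv x0 z)) *m Xhat x0 z).
Proof.
move=> uEh; rewrite vf_repE /horizontal_field.
set y := chart_inv x0 z.
have [uE uJ] : E y \in unitmx /\ J x0 z \in unitmx.
  by move: uEh; rewrite EhatE unitmx_mul => /andP.
have -> : Xhat x0 z *m rsubmx (invmx (Ehat x0 z)) =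
    XM y *m dual_frame (A y) (XM y) K.
  rewrite /dual_frame -/(E y) !mulmx_rsub; congr rsubmx.
  apply: (can_inj (mulmxK uEh)); rewrite mulmxKV// EhatE mulmxA.
  by rewrite mulmxKV.
rewrite -row_mul; congr row; rewrite /horizontal_frame /sharp_mx.
by rewrite /Xhat trmx_mul !mulmxA.
Qed.

Lemma smooth_horizontal_field s x0 : E x0 \in unitmx ->
  smooth_near (vf_rep (horizontal_field s) x0) (chart x0 x0).
Proof.
move=> uE.
pose F z := (Xhat x0 z *m rsubmx (invmx (Ehat x0 z)))^T *m
    invmx (Q (chart_inv x0 z)) *m Xhat x0 z.
have sF : smooth_mx F (chart x0 x0).
  apply: smooth_mxM; last exact: smooth_Xhat.
  apply: smooth_mxM; last first.
    apply: smooth_invmx; last exact: smooth_gram.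
    rewrite chart_invK0; exact: posdef_unit (gram_pos freeX metric_g x0).
  apply: smooth_mxT; apply: smooth_mxM; first exact: smooth_Xhat.
  move=> i j; under eq_fun do rewrite mxE.
  apply: smooth_invmx; last exact: smooth_Ehat.
  by rewrite EhatE J1 mulmx1 chart_invK0.
apply: (@smooth_near_ext _ _ _ (fun z => row s (F z))).
  by apply: filterS (near_unit uE) => z uz; rewrite horizontal_field_rep.
by apply: smooth_near_rV => j; under eq_fun do rewrite mxE.
Qed.

Lemma near_complete_frame x0 : E x0 \in unitmx ->
  \forall x \near x0, E x \in unitmx.
Proof.
move=> uE.
have n1 : \forall x \near x0, Ehat x0 (chart x0 x) \in unitmx.
  exact: chart_cvg (mem_chart_dom x0) _ (near_unit uE).
apply: filterS2 n1 (nbhs_chart_dom (mem_chart_dom x0)) => x ux dx.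
by have := unit_Ehat ux; rewrite chart_invK.
Qed.

Lemma horizontal_field_span x : E x \in unitmx ->
  free [tuple horizontal_field i x | i < r] /\
  H x = [set` <<[tuple horizontal_field i x | i < r]>>%VS].
Proof.
move=> uE.
have FE : \matrix_i (horizontal_field i x : 'rV_(k + r)) =
    horizontal_frame (A x) (XM x) (Q x) K.
  by apply/row_matrixP => i; rewrite rowK.
split.
  rewrite (free_rows (fun i => horizontal_field i x : 'rV_(k + r))) FE.
  apply: (horizontal_frame_free uE) => c.
  exact: (sharp_inj metric_g nondegenerate).
apply/seteqP; split=> v.
  move=> /(horizontalP Phi metric_g)/(horizontal_frame_span _ uE)[u vE].
  apply/(mem_span_rows (fun i => horizontal_field i x : 'rV_(k + r))).
  by exists u; rewrite FE.
move=> /(mem_span_rows (fun i => horizontal_field i x : 'rV_(k + r)))[u].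
rewrite FE => vE; apply/(horizontalP Phi metric_g).
by apply/(horizontal_frame_span _ uE); exists u.
Qed.

End WithCoefficients.

(** The coefficients [K] are chosen at [x0] and kept constant; since invertibility is an open
    condition, they still complete the generators to a frame at nearby points. *)
Lemma horizontal_smooth_distribution : smooth_distribution H.
Proof.
exists r => x0.
have fA := generator_mx_free actionPhi freePhi x0.
have full := row_full_generators (sharp_inj metric_g nondegenerate (x := x0)).
have [K uK] := complete_basis fA full.
exists (interior [set x | col_mx (A x) (K *m XM x) \in unitmx]); split.
- exact: open_interior.
- exact: near_complete_frame.
- exists (horizontal_field K); split=> [i x /interior_subset uE|x /interior_subset uE].
    exact: smooth_horizontal_field.
  exact: horizontal_field_span.
Qed.

End SmoothFrame.

Theorem proposition4p5 (R : realType) (n k d : nat)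
    (M : manifoldType R n) (G : lieGroupType R k) (Phi : G -> M -> M)
    (X0 : forall x : M, tangent x) (X : 'I_d -> forall x : M, tangent x)
    (g : forall x : M, tangent x -> tangent x -> R)
    (actionPhi : smooth_left_action Phi)
    (freePhi : free_action Phi)
    (properPhi : proper_action Phi)
    (smoothX0 : smooth_vf X0)
    (smoothX : forall i, smooth_vf (X i))
    (freeX : forall x, free [tuple X i x | i < d])
    (metric_g : sub_riemannian_metric (distribution_span X) g)
    (invariant_g : invariant_metric Phi (distribution_span X) g)
    (invariantS : invariant_system Phi X0 X g)
    (nondegenerate : forall x : M,
       set_inj (momentum_zero Phi x) (fiber_derivative (H_df X g) x)) :
  principal_connection Phi
    (fun x => fiber_derivative (H_df X g) x @` momentum_zero Phi x).
Proof.
split.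
(* A point is needed to deduce [k <= n] from the independence of the generators; on an empty
   manifold any rank will do. *)
- have [[x0 _]|noM] := pselect (exists x : M, True); last first.
    by exists 0 => x; case: noM; exists x.
  have kn : (k <= n)%N.
    have /eqP <- := generator_mx_free actionPhi freePhi x0; exact: rank_leq_col.
  have [r nE] : exists r, n = (k + r)%N by exists (n - k)%N; rewrite subnKC.
  (* Writing the dimension as [k + r] makes the generators and the [r] completing fields a square
     block matrix. *)
  subst n; exact: horizontal_smooth_distribution.
- move=> h x; have [_ invD _] := invariantS.
  exact: tmap_horizontal_image.
- by move=> x; exact: horizontal_vertical_direct_sum.
Qed.
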